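(* Let $d$ be a prime, and let $c_0\in\mathbb{C}$ be a root of $G_{d,n}$ for some positive integer $n$. Set $K = \mathbb{Q}(c_0)$, and let $\alpha\in K$. Suppose that one of the following holds: (i) $d = 2$, $n \geq 3$ and $v_{\mathfrak{p}}(\alpha)=1$ for some prime $\mathfrak{p} \subset \mathcal{O}_K$ lying above $d$; (ii) $d=2$, $\alpha=0$, and $n\geq 3$; (iii) $d > 2$ and $v_{\mathfrak{p}}(\alpha) = 1$ for some prime $\mathfrak{p} \subset \mathcal{O}_K$ lying above $d$; (iv) $d > 2$, $\alpha = 0$, and $n \geq 2$. Then $G_{\infty}(f_{d,c_0}, \alpha)$ is non-abelian.
   Context: For a prime $d$ and $c_0\in\mathbb{C}$, $f_{d,c_0}=x^d+c_0$. For a polynomial $f$, $f^n$ denotes the $n$-th iterate: $f^0=x$, $f^n=f\circ f^{n-1}$ for $n\ge 1$. Define polynomials $a_i=a_i(c)\in\mathbb{Z}[c]$ (depending on $d$) by $a_1=c$ and $a_{i+1}=a_i^d+c$ for $i\ge 1$. For $n\ge 1$, $G_{d,n}=G_{d,0,n}\in\mathbb{Z}[c]$ is the monic polynomial $$G_{d,n}(c):=\prod_{k\mid n}(a_k)^{\mu(n/k)},$$ where $\mu$ is the Möbius function. (Its roots are the Gleason parameters of period $n$, i.e. those $c_0$ with $f_{d,c_0}^n(0)=0$ and $f_{d,c_0}^i(0)\ne 0$ for $0<i<n$.) For a number field $K$, $f\in K[x]$ of degree at least $2$ and $\alpha\in K$, $G_n(f,\alpha)$ is the Galois group of (the splitting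 field of) $f^n-\alpha$ over $K$, and $G_\infty(f,\alpha)=\varprojlim G_n(f,\alpha)$, the inverse limit with respect to restriction maps (equivalently, the Galois group over $K$ of the field generated by all roots of all $f^n-\alpha$, $n\ge 1$). $\mathcal{O}_K$ is the ring of integers of $K$, and $v_{\mathfrak{p}}$ is the normalized $\mathfrak{p}$-adic valuation on $K$. *)

(* Defs.v *)
From HB Require Import structures.
From mathcomp Require Import all_boot all_order all_algebra all_field.
From mathcomp Require Import ring_quotient boolp reals.
From mathcomp.real_closed Require Import complex.

Set Implicit Arguments.
Unset Strict Implicit.
Unset Printing Implicit Defensive.

Import GRing.Theory.
Local Open Scope ring_scope.

Definition mobius (n : nat) : int :=
  if all (fun p => logn p n == 1%N) (primes n)
  then (-1) ^+ size (primes n) else 0.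

(* a_1 = c and a_(i+1) = a_i ^ d + c; the index 0 is not meaningful. *)
Definition crit_poly (d i : nat) : {poly int} :=
  iter i.-1 (fun a => a ^+ d + 'X) 'X.

(* The product defining G_(d,n) has negative exponents: it is formed in the
   fraction field of Z[c], where it determines G in Z[c] uniquely. *)
Definition is_gleason_poly (d n : nat) (G : {poly int}) : Prop :=
  tofrac G = \prod_(k <- divisors n) tofrac (crit_poly d k) ^ mobius (n %/ k).

Definition unicritical (K : fieldType) (d : nat) (c : K) : {poly K} :=
  'X^d + c%:P.

Definition poly_iter (K : fieldType) (f : {poly K}) (m : nat) : {poly K} :=
  iter m (fun g => f \Po g) 'X.

Section RingOfIntegers.
Variable K : fieldExtType rat.

Definition algebraic_integer : {pred K} :=
  [pred x | `[< integralOver (intr : int -> K) x >] ].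

Fact algebraic_integer_subring : subring_closed algebraic_integer.
Proof.
split=> [|x y|x y]; rewrite ?inE.
- by apply/asboolP; apply: integral1.
- by move=> /asboolP xI /asboolP yI; apply/asboolP; apply: integral_sub.
- by move=> /asboolP xI /asboolP yI; apply/asboolP; apply: integral_mul.
Qed.

HB.instance Definition _ :=
  GRing.isSubringClosed.Build K algebraic_integer algebraic_integer_subring.

Record ring_of_integers := RingOfIntegers {
  oint_val :> K;
  _ : oint_val \in algebraic_integer }.

HB.instance Definition _ := [isSub for oint_val].
HB.instance Definition _ := [Choice of ring_of_integers by <:].
HB.instance Definition _ :=
  [SubChoice_isSubComNzRing of ring_of_integers by <:].

End RingOfIntegers.

Section Valuation.
Variable K : fieldExtType rat.
Local Notation O := (ring_of_integers K).

Fixpoint ideal_pow (P : {pred O}) (k : nat) : O -> Prop :=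
  if k is k'.+1 then
    fun x => exists2 s : seq (O * O),
      forall u, u \in s -> u.1 \in P /\ ideal_pow P k' u.2
      & x = \sum_(u <- s) u.1 * u.2
  else fun=> True.

Definition exact_pow (P : {pred O}) (x : O) (k : nat) : Prop :=
  ideal_pow P k x /\ ~ ideal_pow P k.+1 x.

(* [padic_val P x k] says that x != 0 and v_P(x) = k: x is a quotient a / b of
   nonzero integers with v_P(a) - v_P(b) = k; v_P(0) = +oo satisfies no k. *)
Definition padic_val (P : {pred O}) (x : K) (k : int) : Prop :=
  exists a b : O, exists i j : nat,
    [/\ exact_pow P a i, exact_pow P b j, x * oint_val b = oint_val a
      & k = i%:Z - j%:Z].

End Valuation.

(* Level m is a splitting field over K of f^m - alpha, embedded over K in
   level m + 1. Level 0 is K itself, as f^0 - alpha = x - alpha. *)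
Record preimage_tower (K : fieldType) (f : {poly K}) (alpha : K) := {
  level :> nat -> splittingFieldType K;
  level_split : forall m,
    splittingFieldFor 1%VS
      (map_poly (in_alg (level m)) (poly_iter f m - alpha%:P)) {:level m}%VS;
  level_emb : forall m, {lrmorphism level m -> level m.+1} }.

Section ArborealGroup.
Variables (K : fieldType) (f : {poly K}) (alpha : K).
Variable T : preimage_tower f alpha.

(* [gal_of {:T m}] is G_m(f, alpha), the group of all K-automorphisms of T m. *)
Definition restricts (m : nat) (s : gal_of {:T m.+1}) (t : gal_of {:T m}) :=
  forall x : T m, s (level_emb T m x) = level_emb T m (t x).

Record arboreal_gal := ArborealGal {
  gal_at : forall m, gal_of {:T m};
  gal_at_restricts : forall m, restricts (gal_at m.+1) (gal_at m) }.

Lemma arboreal_gal_eq (s t : arboreal_gal) :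
  (forall m, gal_at s m = gal_at t m) -> s = t.
Proof.
case: s t => [s sP] [t tP] /= st.
have {}st : s = t by apply: functional_extensionality_dep.
by case: _ / st tP => tP; congr ArborealGal; apply: Prop_irrelevance.
Qed.

Fact arboreal_one_subproof (m : nat) :
  restricts (1 : gal_of {:T m.+1})%g (1 : gal_of {:T m})%g.
Proof. by move=> x; rewrite !gal_id. Qed.

Fact arboreal_mul_subproof (s t : arboreal_gal) (m : nat) :
  restricts (gal_at s m.+1 * gal_at t m.+1)%g (gal_at s m * gal_at t m)%g.
Proof. by move=> x; rewrite !galM ?memvf// !gal_at_restricts. Qed.

Fact arboreal_inv_subproof (s : arboreal_gal) (m : nat) :
  restricts (gal_at s m.+1)^-1%g (gal_at s m)^-1%g.
Proof.
have invE n (g : gal_of {:T n}) y : (g^-1)%g (g y) = y.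
  by rewrite -galM ?memvf// mulgV gal_id.
have Einv n (g : gal_of {:T n}) y : g ((g^-1)%g y) = y.
  by rewrite -galM ?memvf// mulVg gal_id.
by move=> x; rewrite -{1}[x](Einv _ (gal_at s m)) -gal_at_restricts invE.
Qed.

Definition arboreal_one := ArborealGal arboreal_one_subproof.
Definition arboreal_mul (s t : arboreal_gal) :=
  ArborealGal (arboreal_mul_subproof s t).
Definition arboreal_inv (s : arboreal_gal) :=
  ArborealGal (arboreal_inv_subproof s).

Fact arboreal_mulA : associative arboreal_mul.
Proof. by move=> s t u; apply: arboreal_gal_eq => m /=; rewrite mulgA. Qed.

Fact arboreal_mul1 : left_id arboreal_one arboreal_mul.
Proof. by move=> s; apply: arboreal_gal_eq => m /=; rewrite mul1g. Qed.

Fact arboreal_mulg1 : right_id arboreal_one arboreal_mul.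
Proof. by move=> s; apply: arboreal_gal_eq => m /=; rewrite mulg1. Qed.

Fact arboreal_mulV : left_inverse arboreal_one arboreal_inv arboreal_mul.
Proof. by move=> s; apply: arboreal_gal_eq => m /=; rewrite mulVg. Qed.

Fact arboreal_mulgV : right_inverse arboreal_one arboreal_inv arboreal_mul.
Proof. by move=> s; apply: arboreal_gal_eq => m /=; rewrite mulgV. Qed.

HB.instance Definition _ := gen_eqMixin arboreal_gal.
HB.instance Definition _ := gen_choiceMixin arboreal_gal.
HB.instance Definition _ := isGroup.Build arboreal_gal
  arboreal_mulA arboreal_mul1 arboreal_mulg1 arboreal_mulV arboreal_mulgV.

End ArborealGroup.

(* Main.v *)
From HB Require Import structures.
Require Import Defs.
From mathcomp Require Import all_boot all_order all_algebra all_field.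
From mathcomp Require Import ring_quotient boolp reals.
From mathcomp.real_closed Require Import complex.
From mathcomp Require Import ring.

(** Write [a_k] for the critical orbit of [f = x ^ d + c], so that [a_n = 0],
    and put [b = a_(n-1)], so that [b ^ d = - c].

    The arithmetic input is that [d] is unramified in K = Q(c). Modulo [d],
    [a_n] is the sum of the [c ^ (d ^ i)] for [i < n], hence
    [c ^ (d ^ n) = c] modulo [d], and the [d ^ n]-th power map is the identity
    on Z[c] modulo [d] ([periodic_frobenius]). This property passes from a ring
    of algebraic integers to all the integers of its field of fractions
    ([integral_frobenius]), so the ring of integers of K has no nilpotents
    modulo [d] ([unramified_radical]). The same argument applies to Z[c, z]
    modulo [1 - z], for a primitive [d]-th root of unity [z]. The hypothesis
    [v_P(alpha) = 1] is used in the form [alpha = d * t / s] with integers [s]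
    and [t] outside [P] ([padic_val1_simple_at]).

    An abelian inverse limit has abelian finite levels, because automorphisms
    of a level lift to the whole tower ([arboreal_abelian]). It remains to
    contradict the commutativity of one finite level in each case.

    For [d = 2], let the target [a] be [alpha] if its valuation is 1, and the
    strictly preperiodic preimage [- b] of 0 if [alpha = 0]. If the extension
    given by the [m]-th preimages of [a] is abelian, then one of [a - c],
    [a_m - a] and [(a_m - a) * (a - c)] is a square in K
    ([abelian_quadratic_squares]). For [m = n], respectively [m = n - 1], the
    last two have valuation 1 at a prime above 2, and the first one is not a
    square because 2 is unramified and it differs from a square by an element
    of valuation 1. For the target [- b] this uses that [c + 1] is a unit.

    For [d > 2] and [v_P(alpha) = 1], level 1 contains a [d]-th root of
    [alpha - c], which is not a [d]-th power in K. In an abelian extension this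
    forces a nontrivial [d]-th root of unity [z] to lie in K
    ([abelian_root_of_unity]), where [1 - z] would be nilpotent modulo [d].

    For [d > 2] and [alpha = 0], level 2 contains a root of unity [z] and a
    [d]-th root [y] of [z * b - c]. Since [d] is unramified in K, some
    automorphism [t] inverts [z] ([cyclotomic_inversion]). Commutativity puts
    [y * t y] in K(z) ([abelian_kummer]); but its [d]-th power is
    [(b - c) ^ 2 + b * c * (1 - z) * (1 - z^-1)], where [b - c] is a [d]-th
    power and [b * c] is a unit, and this is not a [d]-th power modulo
    [(1 - z) ^ 3] ([kummer_not_power]).

    Finally, a root of the Gleason polynomial of index [n] has [a_n = 0] and
    differs from 0 and, for [d = 2], from [-1], by cancellation of Moebius
    values ([gleason_root_periodic], [gleason_root_neq0],
    [gleason_root_neqN1]). *)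

Set Implicit Arguments.
Unset Strict Implicit.
Import GRing.Theory.
Local Open Scope ring_scope.

(** * Divisibility and Frobenius in a subring *)

Section DivisibilityInSubring.
Variables (F : fieldType) (S : subringClosed F).
Implicit Types (x y p : F).

Definition dvd_in p x : Prop := exists2 y, y \in S & x = p * y.

Lemma dvd_in_mulr p y : y \in S -> dvd_in p (p * y).
Proof. by exists y. Qed.

Lemma dvd_inD p x y : dvd_in p x -> dvd_in p y -> dvd_in p (x + y).
Proof.
by move=> [u Su ->] [v Sv ->]; exists (u + v); [rewrite rpredD | rewrite mulrDr].
Qed.

Lemma dvd_inN p x : dvd_in p x -> dvd_in p (- x).
Proof. by move=> [u Su ->]; exists (- u); [rewrite rpredN | rewrite mulrN]. Qed.

Lemma dvd_inB p x y : dvd_in p x -> dvd_in p y -> dvd_in p (x - y).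
Proof. by move=> px /dvd_inN; apply: dvd_inD. Qed.

Lemma dvd_inMl p x y : x \in S -> dvd_in p y -> dvd_in p (x * y).
Proof. by move=> Sx [u Su ->]; exists (x * u); [rewrite rpredM | rewrite mulrCA]. Qed.

Lemma dvd_inMr p x y : y \in S -> dvd_in p x -> dvd_in p (x * y).
Proof. by move=> Sy; rewrite mulrC; apply: dvd_inMl. Qed.

Lemma dvd_in_mul p q x y : dvd_in p x -> dvd_in q y -> dvd_in (p * q) (x * y).
Proof.
by move=> [u Su ->] [v Sv ->]; exists (u * v); [rewrite rpredM | rewrite mulrACA].
Qed.

Lemma dvd_inX p x k : dvd_in p x -> dvd_in (p ^+ k) (x ^+ k).
Proof.
by move=> [u Su ->]; exists (u ^+ k); [rewrite rpredX | rewrite exprMn].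
Qed.

Lemma dvd_in_trans p q x : dvd_in p q -> dvd_in q x -> dvd_in p x.
Proof. by move=> [u Su ->] [v Sv ->]; exists (u * v); [rewrite rpredM | rewrite mulrA]. Qed.

Lemma dvd_in_sum p I (r : seq I) (P : pred I) (E : I -> F) :
  (forall i, P i -> dvd_in p (E i)) -> dvd_in p (\sum_(i <- r | P i) E i).
Proof.
move=> pE; apply: (big_ind (dvd_in p)) => //; last exact: dvd_inD.
by exists 0; [rewrite rpred0 | rewrite mulr0].
Qed.

Lemma dvd_in_cancel p x : p != 0 -> dvd_in p (p * x) -> x \in S.
Proof. by move=> p0 [y Sy /(mulfI p0) ->]. Qed.

Lemma dvd_in_mul2l p q x : p != 0 -> dvd_in (p * q) (p * x) -> dvd_in q x.
Proof. by move=> p0 [y Sy]; rewrite -mulrA => /(mulfI p0) ->; exists y. Qed.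

Lemma dvd_inX_sub p x y k :
  x \in S -> y \in S -> dvd_in p (x - y) -> dvd_in p (x ^+ k - y ^+ k).
Proof.
move=> Sx Sy pxy; rewrite subrXX; apply: dvd_inMr => //.
by apply: rpred_sum => i _; rewrite rpredM ?rpredX.
Qed.

(** Every mixed binomial term contains both [x] and [y] and has a coefficient
    divisible by [d]; the factor [x * y] is what makes second order estimates
    possible. *)
Lemma freshman_dream d x y : prime d -> x \in S -> y \in S ->
  dvd_in (d%:R * (x * y)) ((x + y) ^+ d - (x ^+ d + y ^+ d)).
Proof.
case: d => [|[|d]] // pr_d Sx Sy.
rewrite exprDn big_ord_recl big_ord_recr /= subn0 bin0 binn subnn !expr0.
rewrite !mulr1 !mulr1n mul1r [X in X - _]addrCA addrK.
apply: dvd_in_sum => i _ /=.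
have /dvdnP[k ->] : (d.+2 %| 'C(d.+2, bump 0 i))%N.
  by rewrite prime_dvd_bin // /bump /= add1n ltnS ltn_ord.
have -> : (d.+2 - bump 0 i)%N = (d - i).+1.
  by rewrite /bump /= add1n subSS subSn // -ltnS.
exists (x ^+ (d - i) * y ^+ i *+ k); first by rewrite rpredMn // rpredM // rpredX.
by rewrite !exprS mulrnA -[in LHS]mulr_natl; ring.
Qed.

Lemma frobeniusD d x y : prime d -> x \in S -> y \in S ->
  dvd_in d%:R ((x + y) ^+ d - (x ^+ d + y ^+ d)).
Proof.
move=> pr_d Sx Sy; apply: dvd_in_trans (freshman_dream pr_d Sx Sy).
by apply: dvd_in_mulr; rewrite rpredM.
Qed.

Lemma frobeniusB d x y : prime d -> x \in S -> y \in S ->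
  dvd_in d%:R ((x - y) ^+ d - (x ^+ d - y ^+ d)).
Proof.
move=> pr_d Sx Sy.
have /dvd_inN := frobeniusD pr_d (rpredB Sx Sy) Sy.
by rewrite subrK opprB -addrA -[X in _ + X]opprB.
Qed.

Lemma frobenius_iterB d n x y : prime d -> x \in S -> y \in S ->
  dvd_in d%:R ((x - y) ^+ (d ^ n) - (x ^+ (d ^ n) - y ^+ (d ^ n))).
Proof.
move=> pr_d Sx Sy; elim: n => [|n IHn].
  by rewrite expn0 !expr1 subrr; exists 0; [rewrite rpred0 | rewrite mulr0].
have Sxn : x ^+ (d ^ n) \in S by rewrite rpredX.
have Syn : y ^+ (d ^ n) \in S by rewrite rpredX.
have := dvd_inX_sub d (rpredX _ (rpredB Sx Sy)) (rpredB Sxn Syn) IHn.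
move/dvd_inD/(_ (frobeniusB pr_d Sxn Syn)).
by rewrite addrA subrK expnSr !exprM.
Qed.

Lemma frobenius_iterate p x q i : p \in S ->
  x \in S -> dvd_in p (x ^+ q - x) -> dvd_in p (x ^+ (q ^ i) - x).
Proof.
move=> Sp Sx pxq; elim: i => [|i IHi].
  by rewrite expr1 subrr; exists 0; [rewrite rpred0 | rewrite mulr0].
have := dvd_inX_sub q (rpredX _ Sx) Sx IHi.
by move/dvd_inD/(_ pxq); rewrite addrA subrK expnSr exprM.
Qed.

(** A ring on which some power of Frobenius is the identity has no
    nilpotents. *)
Lemma radical_in p x q k : (1 < q)%N -> p \in S -> x \in S ->
  dvd_in p (x ^+ q - x) -> dvd_in p (x ^+ k) -> dvd_in p x.
Proof.
move=> q1 Sp Sx pxq pxk.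
have kq : (k <= q ^ k)%N by apply: ltnW; apply: ltn_expl.
have := frobenius_iterate k Sp Sx pxq.
rewrite -(subnK kq) exprD => pk.
have := dvd_inMl (rpredX (q ^ k - k) Sx) pxk.
by move/dvd_inB/(_ pk); rewrite opprB addrCA subrr addr0.
Qed.

End DivisibilityInSubring.

(** * Algebraic integers, and congruences for the Frobenius map *)

Section IntegralElements.
Variable F : fieldType.

Definition integral_elt : {pred F} :=
  [pred x | `[< integralOver (intr : int -> F) x >] ].

Fact integral_elt_subring : subring_closed integral_elt.
Proof.
split=> [|x y|x y]; rewrite ?inE.
- by apply/asboolP; apply: integral1.
- by move=> /asboolP xI /asboolP yI; apply/asboolP; apply: integral_sub.
- by move=> /asboolP xI /asboolP yI; apply/asboolP; apply: integral_mul.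
Qed.

HB.instance Definition _ :=
  GRing.isSubringClosed.Build F integral_elt integral_elt_subring.

Lemma integral_eltP x :
  reflect (integralOver (intr : int -> F) x) (x \in integral_elt).
Proof. by rewrite inE; apply: asboolP. Qed.

Lemma integral_elt_root k x : (0 < k)%N ->
  x ^+ k \in integral_elt -> x \in integral_elt.
Proof.
move=> k0 xk; apply/integral_eltP.
apply: (@integral_root_monic _ _ _ x ('X^k - (x ^+ k)%:P)).
- by rewrite monicXnsubC.
- by rewrite rootE !hornerE subrr.
- apply/integral_poly => i; rewrite coefB coefXn coefC.
  apply: integral_sub; first exact: integral_nat.
  by case: eqP => _; [apply/integral_eltP | apply: integral0].
Qed.

Inductive generated (gens : seq F) : F -> Prop :=
| Generated1 : generated gens 1
| GeneratedIn x of x \in gens : generated gens x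
| GeneratedB x y of generated gens x & generated gens y :
    generated gens (x - y)
| GeneratedM x y of generated gens x & generated gens y :
    generated gens (x * y).

Definition subring_gen gens : {pred F} := [pred x | `[< generated gens x >] ].

Fact subring_gen_closed gens : subring_closed (subring_gen gens).
Proof.
split=> [|x y|x y]; rewrite ?inE.
- by apply/asboolP; apply: Generated1.
- by move=> /asboolP gx /asboolP gy; apply/asboolP; apply: GeneratedB.
- by move=> /asboolP gx /asboolP gy; apply/asboolP; apply: GeneratedM.
Qed.

HB.instance Definition _ gens :=
  GRing.isSubringClosed.Build F (subring_gen gens) (subring_gen_closed gens).

Lemma subring_genP gens x : reflect (generated gens x) (x \in subring_gen gens).
Proof. by rewrite inE; apply: asboolP. Qed.

Lemma mem_subring_gen gens x : x \in gens -> x \in subring_gen gens.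
Proof. by move=> gx; apply/subring_genP; apply: GeneratedIn. Qed.

Lemma subring_gen_sub (S : subringClosed F) gens :
  {in gens, forall x, x \in S} -> {subset subring_gen gens <= S}.
Proof.
move=> gS x /subring_genP; elim=> [|y /gS //|y z _ Sy _ Sz|y z _ Sy _ Sz].
- exact: rpred1.
- exact: rpredB.
- exact: rpredM.
Qed.

(** The elements fixed by the [d ^ n]-th power map modulo [p] form a ring as
    soon as [p] divides the prime [d]; so it is enough to look at generators. *)
Lemma subring_gen_frobenius (gens : seq F) d n p : prime d ->
    dvd_in (subring_gen gens) p d%:R ->
    {in gens, forall x, dvd_in (subring_gen gens) p (x ^+ (d ^ n) - x)} ->
  {in subring_gen gens, forall x, dvd_in (subring_gen gens) p (x ^+ (d ^ n) - x)}.
Proof.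
move=> pr_d pd frob_gens x /subring_genP.
elim=> [|y /frob_gens //|y z gy py gz pz|y z gy py gz pz].
- by rewrite expr1n subrr; exists 0; [rewrite rpred0 | rewrite mulr0].
- have Sy : y \in subring_gen gens by apply/subring_genP.
  have Sz : z \in subring_gen gens by apply/subring_genP.
  have := dvd_in_trans pd (frobenius_iterB n pr_d Sy Sz).
  by move/dvd_inD/(_ (dvd_inB py pz)); congr dvd_in; ring.
have Sy : y \in subring_gen gens by apply/subring_genP.
have Sz : z \in subring_gen gens by apply/subring_genP.
have := dvd_inD (dvd_inMl (rpredX (d ^ n) Sy) pz) (dvd_inMr Sz py).
by congr dvd_in; rewrite exprMn; ring.
Qed.

Section Saturation.
Variables (S : subringClosed F) (p : F) (q : nat).
Hypotheses (Sp : p \in S) (p0 : p != 0) (q1 : (1 < q)%N).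
Hypothesis frobS : {in S, forall x, dvd_in S p (x ^+ q - x)}.

(** If [z] is integral of degree [N], its equation shows that [p] divides
    [(p * z) ^+ N] in [S]; as [S] has no nilpotents modulo [p], it divides
    [p * z] in [S]. *)
Lemma integral_saturated z :
  z \in integral_elt -> p * z \in S -> z \in S.
Proof.
move=> /integral_eltP[P monP /rootP Pz] Spz.
suff : dvd_in S p (p * z) by apply: dvd_in_cancel.
have [N sP] : exists N, size P = N.+1.
  by exists (size P).-1; rewrite prednK // lt0n size_poly_eq0 monic_neq0.
apply: (radical_in q1 Sp Spz (frobS Spz) (k := N)).
have lP : P`_N = 1 by have /monicP := monP; rewrite lead_coefE sP.
have sPF : (size (map_poly (intr : int -> F) P) <= N.+1)%N.
  by rewrite -sP; apply: size_poly.
move: Pz; rewrite (horner_coef_wide _ sPF) big_ord_recr /=.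
rewrite coef_map lP /= mul1r => /eqP; rewrite addrC addr_eq0 => /eqP zN.
rewrite exprMn zN mulrN mulr_sumr; apply: dvd_inN; apply: dvd_in_sum => i _.
rewrite coef_map /= mulrCA.
have -> : p ^+ N = p * (p ^+ (N - i.+1) * p ^+ i).
  by rewrite -exprD -exprS; congr (_ ^+ _); rewrite -addnS subnK.
rewrite -mulrA mulrCA -[X in dvd_in _ _ (_ * (_ * X))]mulrA -exprMn.
apply: dvd_in_mulr; rewrite rpredM ?rpred_int // rpredM // rpredX //.
Qed.

Lemma integral_saturatedX k z :
  z \in integral_elt -> {subset S <= integral_elt} -> p ^+ k * z \in S -> z \in S.
Proof.
move=> Iz SI; elim: k => [|k IHk]; first by rewrite mul1r.
rewrite exprS -mulrA => /integral_saturated h; apply/IHk/h.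
by rewrite rpredM // rpredX // SI.
Qed.

Variables (d j : nat).
Hypothesis pr_d : prime d.
Hypotheses (SI : {subset S <= integral_elt}).
Hypotheses (pd : dvd_in S p d%:R) (dp : dvd_in S d%:R (p ^+ j)).

(** The denominator of [x] over [S] may be taken prime to [d], by saturation;
    such a denominator is invertible modulo [p]. *)
Lemma integral_frobenius N x : (0 < N)%N -> N%:R * x \in S ->
  x \in integral_elt -> dvd_in integral_elt p (x ^+ q - x).
Proof.
move=> N0 SNx Ix.
have [m co_dm NE] := pfactor_coprime pr_d N0.
have Smx : m%:R * x \in S.
  apply: (@integral_saturatedX (j * logn d N)) => //.
    by rewrite rpredM // rpred_nat.
  have [v Sv] := dvd_inX (logn d N) dp; rewrite -exprM => ->.
  have -> : d%:R ^+ logn d N * v * (m%:R * x) = v * (N%:R * x).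
    by rewrite {2}NE natrM natrX; ring.
  exact: rpredM.
have Im : (m%:R : F) \in integral_elt by rewrite rpred_nat.
have subI y : dvd_in S p y -> dvd_in integral_elt p y.
  by case=> u /SI Iu ->; exists u.
have m_frob : dvd_in integral_elt p ((m%:R : F) ^+ q - m%:R).
  by apply/subI/frobS; rewrite rpred_nat.
have mx_frob := subI _ (frobS Smx).
have Ixq : x ^+ q \in integral_elt by rewrite rpredX.
have pm : dvd_in integral_elt p (m%:R * (x ^+ q - x)).
  have := dvd_inB mx_frob (dvd_inMr Ixq m_frob).
  by congr dvd_in; rewrite exprMn; ring.
have dI : dvd_in integral_elt p (d%:R * (x ^+ q - x)).
  by apply: dvd_inMr (subI _ pd); rewrite rpredB.
have d0 : (0 < d)%N by rewrite prime_gt0.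
have [a _ /dvdnP[t]] := Bezoutl m d0; rewrite (eqP co_dm) => tE.
have := dvd_inB (dvd_inMl (rpred_nat _ t) dI) (dvd_inMl (rpred_nat _ a) pm).
congr dvd_in; rewrite !mulrA -mulrBl -!natrM -tE natrD.
by rewrite addrK mul1r.
Qed.
End Saturation.

End IntegralElements.

Arguments integral_elt F : clear implicits.
Arguments subring_gen {F} gens.

(** * The critical orbit *)

Section CriticalOrbit.
Variables (F : fieldType) (d : nat) (c : F).

Definition orb k : F := iter k (fun x => x ^+ d + c) 0.

Lemma orbS k : orb k.+1 = orb k ^+ d + c. Proof. by []. Qed.

Lemma orb1 : (0 < d)%N -> orb 1 = c.
Proof. by move=> d0; rewrite orbS expr0n eqn0Ngt d0 add0r. Qed.

Lemma orb_in (S : subringClosed F) k : c \in S -> orb k \in S.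
Proof.
by move=> Sc; elim: k => [|k IHk]; rewrite ?rpred0 // orbS rpredD // rpredX.
Qed.

Lemma monic_crit_poly k : (1 < d)%N -> crit_poly d k \is monic.
Proof.
move=> d1; suff [] : crit_poly d k \is monic /\ (1 < size (crit_poly d k))%N by [].
elim: k => [|[|k] [mon_a s_a]]; rewrite ?[crit_poly _ _]/= ?monicX ?size_polyX //.
rewrite -[crit_poly d k.+2]/(crit_poly d k.+1 ^+ d + 'X).
move: (crit_poly d k.+1) mon_a s_a => a mona sa.
have s2 : (2 < size (a ^+ d))%N.
  have := size_exp a d; move: sa; case: (size a) => [|[|m]] // _ /= sE.
  by case: (size _) sE d1 => [|[|[|s]]] //=; case: d => [|[|e]] //; rewrite mulSn.
rewrite monicE lead_coefDl ?size_polyX // -monicE monic_exp //.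
by rewrite size_polyDl ?size_polyX // (ltnW s2).
Qed.

Lemma crit_polyE k : (0 < d)%N -> (0 < k)%N ->
  (map_poly (intr : int -> F) (crit_poly d k)).[c] = orb k.
Proof.
move=> d0; case: k => // k _; rewrite /crit_poly -[k.+1.-1]/k.
elim: k => [|k IHk]; first by rewrite orb1 // map_polyX hornerX.
by rewrite iterS rmorphD rmorphXn /= map_polyX hornerD horner_exp hornerX IHk.
Qed.

(** Modulo the prime [d] the orbit is the sum of the [c ^+ (d ^ i)]. *)
Lemma orb_frobenius (S : subringClosed F) k : prime d -> c \in S ->
  dvd_in S d%:R (orb k ^+ d - orb k - (c ^+ (d ^ k) - c)).
Proof.
move=> pr_d Sc; elim: k => [|k IHk].
  exists 0; first exact: rpred0.
  by rewrite expr1 /= expr0n eqn0Ngt prime_gt0 // !subrr mulr0.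
have Sk := orb_in k Sc; have Skd : orb k ^+ d \in S by rewrite rpredX.
have Sd : orb k + (c ^+ (d ^ k) - c) \in S by rewrite rpredD ?rpredB ?rpredX.
have h1 := frobeniusD pr_d Skd Sc.
have h2 := dvd_inX_sub d Skd Sd.
have {}h2 : dvd_in S d%:R ((orb k ^+ d) ^+ d - (orb k + (c ^+ (d ^ k) - c)) ^+ d).
  by apply: h2; move: IHk; congr dvd_in; ring.
have h3 := frobeniusD pr_d Sk (rpredB (rpredX (d ^ k) Sc) Sc).
have h4 := frobeniusB pr_d (rpredX (d ^ k) Sc) Sc.
have := dvd_inD (dvd_inD h1 h2) (dvd_inD h3 h4).
by congr dvd_in; rewrite !orbS expnSr [c ^+ (_ * _)]exprM; ring.
Qed.

Lemma periodic_frobenius (S : subringClosed F) n : prime d -> c \in S ->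
  orb n = 0 -> dvd_in S d%:R (c ^+ (d ^ n) - c).
Proof.
move=> pr_d Sc cn0; have /dvd_inN := orb_frobenius n pr_d Sc.
by rewrite cn0 expr0n eqn0Ngt prime_gt0 //= subrr sub0r opprK.
Qed.

Lemma periodic_integral n : (1 < d)%N -> (0 < n)%N -> orb n = 0 ->
  c \in integral_elt F.
Proof.
move=> d1 n0 cn0; apply/integral_eltP; exists (crit_poly d n).
  exact: monic_crit_poly.
by rewrite rootE crit_polyE ?cn0 // ltnW.
Qed.

Lemma dvd_orb (S : subringClosed F) k : (0 < d)%N -> c \in S ->
  dvd_in S c (orb k).
Proof.
move=> d0 Sc; elim: k => [|k IHk]; first by exists 0; rewrite ?rpred0 ?mulr0.
rewrite orbS; apply: dvd_inD; last by exists 1; rewrite ?rpred1 ?mulr1.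
by rewrite -(prednK d0) exprS; apply: dvd_inMr; rewrite // rpredX // orb_in.
Qed.

(** The constant term of [crit_poly d n / 'X] is 1. *)
Lemma periodic_unit (S : subringClosed F) n : (1 < d)%N -> (0 < n)%N ->
  c \in S -> c != 0 -> orb n = 0 -> exists2 h, h \in S & c * h = 1.
Proof.
move=> d1; case: n => // n _ Sc c0; rewrite orbS.
have [h Sh ->] := dvd_orb n (ltnW d1) Sc.
rewrite -(subnKC d1) !exprS; set y := (c * h) ^+ _ => cE.
exists (- (h * h * y)); first by rewrite rpredN !rpredM // rpredX // rpredM.
apply: (mulfI c0); apply/eqP; rewrite -subr_eq0 -oppr_eq0 -[X in _ == X]cE.
by apply/eqP; ring.
Qed.

End CriticalOrbit.

Arguments orb F d c k : simpl never.

(** * Primes and roots of unity *)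

Section PrimeArithmetic.
Variables (F : fieldType) (d : nat).
Hypothesis char0 : forall m, (m%:R == 0 :> F) = (m == 0%N).
Hypothesis pr_d : prime d.

Let d0 : (0 < d)%N := prime_gt0 pr_d.
Let d1 : (1 < d)%N := prime_gt1 pr_d.
Let dF0 : d%:R != 0 :> F.
Proof. by rewrite char0 -lt0n. Qed.

Lemma subring_gen_nil x : x \in subring_gen [::] -> exists z : int, x = z%:~R :> F.
Proof.
move=> /subring_genP; elim=> [|y //|y z _ [u ->] _ [v ->]|y z _ [u ->] _ [v ->]].
- by exists 1.
- by exists (u - v); rewrite rmorphB.
- by exists (u * v); rewrite rmorphM.
Qed.

(** The ring of rational integers satisfies Fermat's congruence modulo [d], so
    by saturation it would contain the inverse of [d]. *)
Lemma prime_not_unit : ~ dvd_in (integral_elt F) d%:R 1.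
Proof.
move=> [y Iy dy].
have Z1 x : x \in subring_gen [::] ->
    dvd_in (subring_gen [::]) d%:R (x ^+ (d ^ 1) - x :> F).
  by apply: subring_gen_frobenius => //; exists 1; rewrite ?rpred1 ?mulr1.
have := integral_saturated (rpred_nat _ d) dF0 (q := d ^ 1) _ Z1 Iy.
rewrite expn1 -dy rpred1 => /(_ d1 isT)/subring_gen_nil[z yE].
have := dy; rewrite yE => /esym/eqP.
rewrite -[d%:R]/((Posz d)%:~R) -intrM -subr_eq0 -[1]/(1%:~R) -intrB.
have intr0 (t : int) : t%:~R == 0 :> F -> t = 0.
  case: t => m; first by rewrite -pmulrn char0 => /eqP->.
  by rewrite NegzE mulrNz oppr_eq0 -pmulrn char0.
move=> /intr0/eqP; rewrite subr_eq0 => /eqP dz.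
have := congr1 absz dz; rewrite abszM /= => /eqP; rewrite muln_eq1.
by move=> /andP[/eqP d_1]; move: d1; rewrite d_1.
Qed.

Section RootOfUnity.
Variable z : F.
Hypotheses (zd : z ^+ d = 1) (z1 : z != 1).

Lemma prime_primitive_root : d.-primitive_root z.
Proof.
have [m md m_dvd] := prim_order_exists d0 zd.
case/primeP: pr_d => _ /(_ m m_dvd) /pred2P[] mE; last by rewrite -mE.
by have := prim_expr_order md; rewrite mE expr1 => z_1; move: z1; rewrite z_1 eqxx.
Qed.

Lemma sum_Xn_factor :
  \sum_(i < d) 'X^i = \prod_(1 <= i < d) ('X - (z ^+ i)%:P) :> {poly F}.
Proof.
have X1 : 'X - 1%:P != 0 :> {poly F} by rewrite polyXsubC_eq0.
apply: (mulfI X1).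
have := factor_Xn_sub_1 prime_primitive_root.
by rewrite big_ltn // expr0 subrX1 polyC1 => <-.
Qed.

Lemma prime_prod_1B : d%:R = \prod_(1 <= i < d) (1 - z ^+ i).
Proof.
have := congr1 (fun p => p.[1]) sum_Xn_factor.
rewrite horner_sum horner_prod => E.
rewrite (eq_bigr (fun i => ('X - (z ^+ i)%:P).[1])); last first.
  by move=> i _; rewrite !hornerE.
rewrite -E (eq_bigr (fun=> 1)); first by rewrite sumr_const card_ord.
by move=> i _; rewrite hornerXn expr1n.
Qed.

(** Frobenius is additive modulo [d], so it sends [1 - z] to [1 - z ^+ d]. *)
Lemma dvd_root_1BX (S : subringClosed F) : z \in S ->
  dvd_in S d%:R ((1 - z) ^+ d).
Proof.
move=> Sz; have := frobeniusB pr_d (rpred1 S) Sz.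
by rewrite expr1n zd subrr subr0.
Qed.

(** The factors [1 - z] and [1 - z ^+ 2] of [d] are both multiples of [1 - z]. *)
Lemma root_1B_sqr_dvd (S : subringClosed F) : (2 < d)%N -> z \in S ->
  dvd_in S ((1 - z) ^+ 2) d%:R.
Proof.
move=> d2 Sz; rewrite prime_prod_1B big_ltn // big_ltn // expr1.
exists ((1 + z) * \prod_(3 <= i < d) (1 - z ^+ i)); last by ring.
rewrite rpredM ?rpredD ?rpred1 // rpred_prod // => i _.
by rewrite rpredB ?rpred1 ?rpredX.
Qed.

End RootOfUnity.
End PrimeArithmetic.

(** * Ramification in the field of a periodic parameter *)

Section Denominators.
Variables (F : fieldType) (gens : seq F).

(** Membership in the field of fractions of the ring generated by [gens], when
    these are algebraic: the denominator can then be taken in the integers. *)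
Definition has_denominator x : Prop :=
  exists2 N, (0 < N)%N & N%:R * x \in subring_gen gens.

Lemma has_denominator_in x : x \in subring_gen gens -> has_denominator x.
Proof. by exists 1%N; rewrite ?mul1r. Qed.

Lemma has_denominatorB x y :
  has_denominator x -> has_denominator y -> has_denominator (x - y).
Proof.
move=> [M M0 Mx] [N N0 Ny]; exists (M * N)%N; first by rewrite muln_gt0 M0.
have -> : (M * N)%:R * (x - y) = N%:R * (M%:R * x) - M%:R * (N%:R * y).
  by rewrite natrM; ring.
by rewrite rpredB // rpredM // rpred_nat.
Qed.

Lemma has_denominatorM x y :
  has_denominator x -> has_denominator y -> has_denominator (x * y).
Proof.
move=> [M M0 Mx] [N N0 Ny]; exists (M * N)%N; first by rewrite muln_gt0 M0.
by rewrite natrM mulrACA rpredM.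
Qed.

End Denominators.

Section PeriodicArithmetic.
Variables (F : fieldType) (d n : nat) (c : F).
Hypothesis char0 : forall m, (m%:R == 0 :> F) = (m == 0%N).
Hypotheses (pr_d : prime d) (n0 : (0 < n)%N) (cn0 : orb d c n = 0).
Local Notation O := (integral_elt F).
Local Notation Zc := (subring_gen [:: c]).

Let d1 : (1 < d)%N := prime_gt1 pr_d.
Let d0 : (0 < d)%N := prime_gt0 pr_d.
Let dF0 : d%:R != 0 :> F.
Proof. by rewrite char0 -lt0n. Qed.
Let q1 : (1 < d ^ n)%N.
Proof. by rewrite -(exp1n n) ltn_exp2r. Qed.
Let Zcc : c \in Zc.
Proof. by rewrite mem_subring_gen ?mem_head. Qed.
Let Oc : c \in O := periodic_integral d1 n0 cn0.
Let Oorb k : orb d c k \in O := orb_in d k Oc.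

Lemma subring_gen_integral : {subset Zc <= O}.
Proof. by apply: subring_gen_sub => x; rewrite inE => /eqP->. Qed.

(** The prime [d] is unramified in Q(c): the algebraic integers of that field
    have no nilpotents modulo [d]. *)
Lemma unramified_frobenius x : x \in O -> has_denominator [:: c] x ->
  dvd_in O d%:R (x ^+ (d ^ n) - x).
Proof.
move=> Ox [N N0 Nx].
have dd : dvd_in Zc d%:R d%:R by exists 1; rewrite ?rpred1 ?mulr1.
apply: (@integral_frobenius _ Zc d%:R _ _ _ _ _ d 1 _ _ _ _ N) => //.
- by rewrite rpred_nat.
- apply: subring_gen_frobenius => // y; rewrite inE => /eqP->.
  exact: periodic_frobenius.
- exact: subring_gen_integral.
Qed.

Lemma unramified_radical x k : x \in O -> has_denominator [:: c] x ->
  dvd_in O d%:R (x ^+ k) -> dvd_in O d%:R x.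
Proof.
move=> Ox dx; apply: radical_in q1 _ Ox (unramified_frobenius Ox dx).
by rewrite rpred_nat.
Qed.

(** Otherwise [1 - z] would be divisible by [d], hence [d] by [d ^+ 2]. *)
Lemma no_root_of_unity z : (2 < d)%N -> has_denominator [:: c] z ->
  z ^+ d = 1 -> z = 1.
Proof.
move=> d2 dz zd; apply/eqP/negPn/negP => z1.
have Oz : z \in O by apply: (@integral_elt_root F d) => //; rewrite zd rpred1.
have d1z : dvd_in O d%:R (1 - z).
  apply: (@unramified_radical _ d); first by rewrite rpredB ?rpred1.
    by apply: has_denominatorB => //; apply: has_denominator_in; rewrite rpred1.
  exact: dvd_root_1BX.
have := dvd_in_trans (dvd_inX 2 d1z) (root_1B_sqr_dvd pr_d zd z1 d2 Oz).
rewrite expr2 -[X in dvd_in _ _ X]mulr1 => /(dvd_in_mul2l dF0).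
exact: prime_not_unit.
Qed.

(** A multiple of [1 - z] that lies in Q(c) is nilpotent modulo [d]. *)
Lemma dvd_root_1B x y z : has_denominator [:: c] x -> y \in O ->
  z ^+ d = 1 -> x = (1 - z) * y -> dvd_in O d%:R x.
Proof.
move=> dx Oy zd xE.
have Oz : z \in O by apply: (@integral_elt_root F d) => //; rewrite zd rpred1.
apply: (@unramified_radical _ d) => //; first by rewrite xE rpredM ?rpredB ?rpred1.
rewrite xE exprMn; apply: dvd_inMr; first by rewrite rpredX.
exact: dvd_root_1BX.
Qed.

(** [v_P(alpha) = 1] without a valuation: [alpha = d * t / s], where [s] and
    [t] are integers outside the prime [Q] containing [d]. *)
Definition simple_at (Q : F -> Prop) alpha :=
  [/\ forall x, x \in O -> Q (d%:R * x),
      forall x y, x \in O -> y \in O -> Q (x * y) -> Q x \/ Q y, ~ Q 1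
    & exists s t, [/\ s \in O, t \in O, ~ Q s, ~ Q t & alpha * s = d%:R * t]].

(** As [- c = b ^+ d], a [d]-th root [x] of [alpha - c] is congruent to [b]
    modulo [d]; but then [alpha = x ^+ d - b ^+ d] is divisible by [d ^+ 2],
    against its valuation being 1. *)
Lemma simple_at_not_power (Q : F -> Prop) alpha x :
  simple_at Q alpha -> (forall y, has_denominator [:: c] y) ->
  x ^+ d <> alpha - c.
Proof.
move=> [Qd QM Q1 [s [t [Os Ot Qs Qt asdt]]]] den xd.
have QX y k : y \in O -> Q (y ^+ k) -> Q y.
  move=> Oy; elim: k => [/Q1 //|k IHk]; rewrite exprS => /QM.
  by case=> //; rewrite rpredX.
set b := orb d c n.-1.
have bd : b ^+ d = - c.
  by apply/eqP; rewrite -addr_eq0 -orbS prednK // cn0.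
have Ob : b \in O by apply: Oorb.
have sxd : (s * x) ^+ d = s ^+ d.-1 * (d%:R * t) + (s * b) ^+ d.
  by rewrite !exprMn xd bd mulrBr mulrN -asdt -{1}(prednK d0) exprSr; ring.
have Osx : s * x \in O.
  apply: (@integral_elt_root F d) => //; rewrite sxd.
  by rewrite rpredD ?rpredX ?rpredM ?rpredX ?rpred_nat.
have Osb : s * b \in O by rewrite rpredM.
(* Multiplication by [s] makes the root [x] integral. *)
set w := s * x - s * b.
have Ow : w \in O by rewrite rpredB.
have dw : dvd_in O d%:R w.
  apply: (@unramified_radical _ d) => //.
  have := dvd_inD (frobeniusB pr_d Osx Osb)
    (dvd_in_mulr d%:R (rpredM (rpredX d.-1 Os) Ot)).
  by congr dvd_in; rewrite sxd; ring.
have dst : dvd_in O (d%:R * d%:R) (d%:R * (s ^+ d.-1 * t)).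
  have wd : dvd_in O (d%:R * d%:R) (w ^+ d).
    rewrite -[X in w ^+ X](subnKC d1) !exprS mulrA; apply: dvd_inMr; first by rewrite rpredX.
    exact: dvd_in_mul.
  have dsbw : dvd_in O (d%:R * d%:R) (d%:R * (s * b * w)).
    by apply: dvd_in_mul; [exists 1; rewrite ?rpred1 ?mulr1 | apply: dvd_inMl].
  have := dvd_inD wd (dvd_in_trans dsbw (freshman_dream pr_d Osb Ow)).
  have -> : s * b + w = s * x by rewrite /w; ring.
  by congr dvd_in; rewrite sxd; ring.
have [y Oy sty] := dvd_in_mul2l dF0 dst.
have : Q (s ^+ d.-1 * t) by rewrite sty; apply: Qd.
by case/QM=> //; [rewrite rpredX | move/QX => /(_ Os)].
Qed.
End PeriodicArithmetic.

(** * Valuations and squares *)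

Section SimplePoint.
Variables (F : fieldType) (d n : nat) (c : F).
Hypothesis char0 : forall m, (m%:R == 0 :> F) = (m == 0%N).
Hypotheses (pr_d : prime d) (n0 : (0 < n)%N) (cn0 : orb d c n = 0).
Hypotheses (c0 : c != 0) (den : forall y, has_denominator [:: c] y).
Local Notation O := (integral_elt F).
Let d1 : (1 < d)%N := prime_gt1 pr_d.
Let dF0 : d%:R != 0 :> F.
Proof. by rewrite char0 -lt0n prime_gt0. Qed.

Lemma periodic_unit_integral : exists2 h, h \in O & c * h = 1.
Proof. by apply: periodic_unit cn0; rewrite // (periodic_integral d1 n0 cn0). Qed.

(** Both right-hand sides have valuation 1, since [c] is a unit. *)
Lemma simple_at_not_square Q alpha x : simple_at d Q alpha ->
  x ^+ 2 <> - alpha /\ x ^+ 2 <> - alpha * (alpha - c).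
Proof.
move=> [Qd QM Q1 [s [t [Os Ot Qs Qt asdt]]]].
have QX y k : y \in O -> Q (y ^+ k) -> Q y.
  move=> Oy; elim: k => [/Q1 //|k IHk]; rewrite exprS => /QM.
  by case=> //; rewrite rpredX.
have Qst k : ~ dvd_in O d%:R (s ^+ k * t).
  move=> [y Oy sty]; have : Q (s ^+ k * t) by rewrite sty; apply: Qd.
  by case/QM=> //; [rewrite rpredX | move/QX => /(_ Os)].
have Od : d%:R \in O by rewrite rpred_nat.
have Oc : c \in O by apply: periodic_integral cn0.
have sqr y w : w \in O -> y ^+ 2 = d%:R * w -> dvd_in O d%:R w.
  move=> Ow yE; have Oy : y \in O.
    by apply: (@integral_elt_root F 2); rewrite // yE rpredM.
  have dy : dvd_in O d%:R (y ^+ 2) by exists w.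
  have := dvd_inX 2 (unramified_radical char0 pr_d n0 cn0 Oy (den y) dy).
  by rewrite yE expr2 => /(dvd_in_mul2l dF0).
split=> xE.
  apply: (Qst 1); rewrite -[_ * t]opprK; apply: dvd_inN.
  apply: (sqr (s * x)); first by rewrite rpredN rpredM ?rpredX.
  by rewrite exprMn xE; transitivity (- (alpha * s) * s); [ring | rewrite asdt; ring].
apply: (Qst 3); have [h Oh ch] := periodic_unit_integral.
rewrite -[_ * t]mulr1 -[X in dvd_in _ _ (_ * X)]ch mulrA; apply: dvd_inMr => //.
have : dvd_in O d%:R (s ^+ 2 * t * (c * s - d%:R * t)).
  apply: (sqr (s ^+ 2 * x)).
    by rewrite rpredM ?rpredB ?rpredM ?rpredX.
  by rewrite exprMn xE; transitivity (s ^+ 2 * (alpha * s) * (c * s - alpha * s));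
    [ring | rewrite asdt; ring].
move/dvd_inD/(_ (dvd_inMl (rpredM (rpredX 2 Os) Ot) (dvd_in_mulr d%:R Ot))).
by congr dvd_in; ring.
Qed.
End SimplePoint.

Section QuadraticArithmetic.
Variables (F : fieldType) (n : nat) (c : F).
Hypothesis char0 : forall m, (m%:R == 0 :> F) = (m == 0%N).
Hypotheses (n0 : (0 < n)%N) (cn0 : orb 2 c n = 0).
Hypotheses (c0 : c != 0) (c1 : c != -1).
Local Notation O := (integral_elt F).
Let Oc : c \in O := periodic_integral (isT : 1 < 2)%N n0 cn0.
Let Oc1 : c + 1 \in O.
Proof. by rewrite rpredD ?rpred1. Qed.
Let c1_0 : c + 1 != 0.
Proof. by rewrite addr_eq0. Qed.

(** For the parameter [-1] the critical orbit alternates between 0 and [-1];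
    the congruence on [h] says that the zeros at even times are simple. *)
Lemma orb_mod_c1 k :
  dvd_in O (c + 1) (orb 2 c k.*2.+1 + 1) /\
  exists h, [/\ h \in O, orb 2 c k.*2.+2 = (c + 1) * h & dvd_in O (c + 1) (h - c)].
Proof.
have odd_step x : x \in O -> dvd_in O (c + 1) x -> dvd_in O (c + 1) (x ^+ 2 + c + 1).
  move=> Ox cx; rewrite -addrA; apply: dvd_inD; last by exists 1; rewrite ?rpred1 ?mulr1.
  by rewrite expr2; apply: dvd_inMl.
have even_step h : h \in O -> exists h', [/\ h' \in O,
    (((c + 1) * h) ^+ 2 + c) ^+ 2 + c = (c + 1) * h' & dvd_in O (c + 1) (h' - c)].
  move=> Oh; exists ((c + 1) ^+ 3 * h ^+ 4 + 2%:R * c * (c + 1) * h ^+ 2 + c); split.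
  - by rewrite !rpredD // !rpredM ?rpredX // rpred_nat.
  - by ring.
  exists ((c + 1) ^+ 2 * h ^+ 4 + 2%:R * c * h ^+ 2); last by ring.
  by rewrite rpredD // !rpredM ?rpredX // rpred_nat.
elim: k => [|k [_ [h [Oh hE _]]]].
  split; first by apply: (odd_step 0); [rewrite rpred0 | exists 0; rewrite ?rpred0 ?mulr0].
  by have := even_step 0 (rpred0 _); rewrite mulr0.
have E1 : orb 2 c k.+1.*2.+1 = orb 2 c k.*2.+2 ^+ 2 + c by [].
have E2 : orb 2 c k.+1.*2.+2 = (orb 2 c k.*2.+2 ^+ 2 + c) ^+ 2 + c by [].
rewrite E1 E2 hE; split; last exact: even_step.
by apply: odd_step; [rewrite rpredM | apply: dvd_in_mulr].
Qed.

(** A period [n] of the critical orbit forces [c + 1] to divide 1 if [n] is odd,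
    and to divide the unit [c] if [n] is even. *)
Lemma periodic_c1_unit : exists2 h, h \in O & (c + 1) * h = 1.
Proof.
have [h Oh ch] : exists2 h, h \in O & c * h = 1.
  exact: (periodic_unit (isT : 1 < 2)%N n0 Oc c0 cn0).
suff [u Ou u1] : dvd_in O (c + 1) 1 by exists u.
have [odd_n | even_n] := boolP (odd n).
  have := (orb_mod_c1 n./2).1; rewrite -[X in orb 2 c X]add1n.
  by have := odd_double_half n; rewrite odd_n => ->; rewrite cn0 add0r.
have := (orb_mod_c1 n./2.-1).2; have := odd_double_half n.
rewrite (negPf even_n) add0n; case: n./2 => [nE|m nE].
  by move: n0; rewrite -nE.
rewrite -[m.+1.-1]/m -doubleS nE cn0 => -[g [_ /eqP]].
rewrite eq_sym mulf_eq0 (negPf c1_0) /= => /eqP->; rewrite sub0r => /dvd_inN.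
by rewrite opprK => /(dvd_inMr Oh); rewrite ch.
Qed.

Let b := orb 2 c n.-1.

(** With [t = orb 2 c n.-2] one has [- b - c = t ^+ 2 - 2 * b], where [b] and [t]
    are units at 2, as [c] and [c + 1] are. So the last two values have
    valuation 1 at the unramified prime 2, while a square root of the first
    one would be [t + 2 * r], making [b] even. *)
Lemma quadratic_not_square x : (1 < n)%N -> has_denominator [:: c] x ->
  [/\ x ^+ 2 <> - b - c, x ^+ 2 <> 2%:R * b & x ^+ 2 <> 2%:R * b * (- b - c)].
Proof.
move=> n1 dx; pose t := orb 2 c n.-2.
have bE : b = t ^+ 2 + c by rewrite /b -[n.-1]prednK // -subn1 subn_gt0.
have b2 : b ^+ 2 = - c.
  by apply/eqP; rewrite -addr_eq0 -orbS prednK // cn0.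
have Ob : b \in O by apply: orb_in.
have Ot : t \in O by apply: orb_in.
have O2 : 2%:R \in O by rewrite rpred_nat.
have F2 : 2%:R != 0 :> F by rewrite char0.
have [h Oh ch] : exists2 h, h \in O & c * h = 1.
  exact: (periodic_unit (isT : 1 < 2)%N n0 Oc c0 cn0).
have [g Og c1g] := periodic_c1_unit.
have no2 : ~ dvd_in O 2%:R 1 by apply: prime_not_unit.
have no2b : ~ dvd_in O 2%:R b.
  have Obh : - (b * h) \in O by rewrite rpredN rpredM.
  by move=> /(dvd_inMr Obh); rewrite mulrN mulrA -expr2 b2 mulNr opprK ch.
have no2t : ~ dvd_in O 2%:R (t ^+ 2).
  move=> [u Ou tE]; apply: no2; have := b2; rewrite bE tE => E.
  have Ohg : h * g \in O by rewrite rpredM.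
  exists (- (2%:R * u ^+ 2 + 2%:R * u * c) * (h * g)).
    by rewrite rpredM // rpredN rpredD // !rpredM // rpredX.
  transitivity (c * h * ((c + 1) * g)); first by rewrite ch c1g mulr1.
  by transitivity ((c ^+ 2 - - c) * (h * g)); [ring | rewrite -E; ring].
have sqr y w : has_denominator [:: c] y -> w \in O -> y ^+ 2 = 2%:R * w ->
    dvd_in O 2%:R y /\ dvd_in O 2%:R w.
  move=> dy Ow yE; have Oy : y \in O.
    by apply: (@integral_elt_root F 2); rewrite // yE rpredM.
  have d2y : dvd_in O 2%:R (y ^+ 2) by exists w.
  have d2 := unramified_radical char0 (isT : prime 2) n0 cn0 Oy dy d2y.
  split=> //; have := dvd_inX 2 d2.
  by rewrite yE [X in dvd_in _ X]expr2 => /(dvd_in_mul2l F2).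
split=> xE.
- pose w := x - t.
  have dw : has_denominator [:: c] w.
    apply: has_denominatorB => //; apply: has_denominator_in.
    by apply: orb_in; rewrite mem_subring_gen ?mem_head.
  have x2 : x ^+ 2 = t ^+ 2 - 2%:R * b by rewrite xE bE; ring.
  have Ox : x \in O.
    by apply: (@integral_elt_root F 2); rewrite // x2 rpredB ?rpredX ?rpredM.
  have [] := sqr w (t ^+ 2 - b - x * t) dw.
  + by rewrite !rpredB ?rpredX ?rpredM.
  + by transitivity (x ^+ 2 - 2%:R * x * t + t ^+ 2);
      [rewrite /w; ring | rewrite x2; ring].
  move=> [r Or wE] _; apply: no2b; exists (- (t * r + r ^+ 2)).
    by rewrite rpredN rpredD ?rpredX ?rpredM.
  have xw : x = t + 2%:R * r by rewrite -wE /w; ring.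
  apply: (mulfI F2); apply/eqP; rewrite -subr_eq0; apply/eqP.
  transitivity ((t + 2%:R * r) ^+ 2 - (t ^+ 2 - 2%:R * b)); first by ring.
  by rewrite -xw x2 subrr.
- by have [_ /no2b] := sqr _ _ dx Ob xE.
have Obb : b * (- b - c) \in O by rewrite rpredM ?rpredB ?rpredN.
rewrite -mulrA in xE; have [_] := sqr _ _ dx Obb xE.
have Oh2 : h * b \in O by rewrite rpredM.
move=> /(dvd_inMr Oh2)[u Ou uE]; apply: no2t; exists (b + - u)%R.
  by rewrite rpredB.
have tE : t ^+ 2 = b - c by rewrite bE; ring.
transitivity (2%:R * b + b ^+ 2 * h * (b + c)); last first.
  by transitivity (2%:R * b - 2%:R * u); [rewrite -uE; ring | ring].
by rewrite b2 tE mulNr ch; ring.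
Qed.
End QuadraticArithmetic.

(** * A Kummer extension of the cyclotomic field *)

Section KummerArithmetic.
Variables (F : fieldType) (d n : nat) (c z : F).
Hypothesis char0 : forall m, (m%:R == 0 :> F) = (m == 0%N).
Hypotheses (pr_d : prime d) (d2 : (2 < d)%N).
Hypotheses (n1 : (1 < n)%N) (cn0 : orb d c n = 0) (c0 : c != 0).
Hypotheses (zd : z ^+ d = 1) (z1 : z != 1).
Local Notation O := (integral_elt F).
Local Notation S := (subring_gen [:: c; z]).
Local Notation pi := (1 - z).
Let d1 : (1 < d)%N := prime_gt1 pr_d.
Let d0 : (0 < d)%N := prime_gt0 pr_d.
Let n0 : (0 < n)%N := ltnW n1.
Let q1 : (1 < d ^ n)%N.
Proof. by rewrite -(exp1n n) ltn_exp2r. Qed.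
Let Sc : c \in S.
Proof. by rewrite mem_subring_gen ?mem_head. Qed.
Let Sz : z \in S.
Proof. by rewrite mem_subring_gen // !inE eqxx orbT. Qed.
Let Spi : pi \in S.
Proof. by rewrite rpredB ?rpred1. Qed.
Let Oc : c \in O := periodic_integral d1 n0 cn0.
Let Oz : z \in O.
Proof. by apply: (@integral_elt_root F d) => //; rewrite zd rpred1. Qed.
Let Opi : pi \in O.
Proof. by rewrite rpredB ?rpred1. Qed.
Let pi0 : pi != 0.
Proof. by rewrite subr_eq0 eq_sym. Qed.

(** Both generators are fixed by the [d ^ n]-th power map modulo [1 - z]. *)
Lemma cyclotomic_frobenius x : x \in O -> has_denominator [:: c; z] x ->
  dvd_in O pi (x ^+ (d ^ n) - x).
Proof.
move=> Ox [N N0 Nx].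
have pid : dvd_in S pi d%:R.
  apply: dvd_in_trans (root_1B_sqr_dvd pr_d zd z1 d2 Sz).
  by rewrite expr2; apply: dvd_in_mulr.
apply: (@integral_frobenius _ S pi _ _ _ _ _ d d _ _ _ _ N) => //.
- apply: subring_gen_frobenius => // y; rewrite !inE => /orP[] /eqP->.
    exact: dvd_in_trans pid (periodic_frobenius pr_d Sc cn0).
  rewrite -(prednK n0) expnS exprM zd expr1n.
  by exists 1; rewrite ?rpred1 ?mulr1.
- by apply: subring_gen_sub => y; rewrite !inE => /orP[] /eqP->.
- exact: dvd_root_1BX.
Qed.

Let b := orb d c n.-1.

(** Up to the [d]-th power [a ^+ (2 * d)], the product is a unit times
    [(1 - z) ^+ 2], while differences of [d]-th powers divisible by [1 - z]
    are divisible by [(1 - z) ^+ 3]. *)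
Lemma kummer_not_power e : has_denominator [:: c; z] e ->
  e ^+ d <> (z * b - c) * (z^-1 * b - c).
Proof.
move=> de eE; pose a := orb d c n.-2.
have bE : b = a ^+ d + c by rewrite /b -[n.-1]prednK // -subn1 subn_gt0.
have bd : b ^+ d = - c.
  by apply/eqP; rewrite -addr_eq0 -orbS prednK // cn0.
have Sa : a \in S by apply: orb_in.
have Oa : a \in O by apply: orb_in.
have Ob : b \in O by apply: orb_in.
have z0 : z != 0.
  by apply: contra_eq_neq zd => ->; rewrite expr0n eqn0Ngt d0 eq_sym oner_eq0.
have Ozi : z^-1 \in O.
  by apply: (@integral_elt_root F d) => //; rewrite exprVn zd invr1 rpred1.
have Oa2 : a ^+ 2 \in O by rewrite rpredX.
have {}eE : e ^+ d = (a ^+ 2) ^+ d - pi ^+ 2 * (b * c * z^-1).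
  by rewrite eE exprAC; have -> : a ^+ d = b - c by [rewrite bE; ring]; field.
have Oe : e \in O.
  by apply: (@integral_elt_root F d); rewrite // eE rpredB ?rpredM ?rpredX ?rpredM.
pose w := e - a ^+ 2; have Ow : w \in O by rewrite rpredB.
have dw : has_denominator [:: c; z] w.
  by apply: has_denominatorB => //; apply: has_denominator_in; rewrite rpredX.
have pi2d : dvd_in O (pi ^+ 2) d%:R by apply: root_1B_sqr_dvd.
have Obcz : b * c * z^-1 \in O by rewrite !rpredM.
have piw : dvd_in O pi w.
  apply: (@radical_in _ _ _ _ _ d q1 Opi Ow (cyclotomic_frobenius Ow dw)).
  have h : dvd_in O pi d%:R.
    by apply: dvd_in_trans pi2d; rewrite expr2; apply: dvd_in_mulr.
  have := dvd_inB (dvd_in_trans h (frobeniusB pr_d Oe Oa2))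
    (dvd_in_mulr pi (rpredM Opi Obcz)).
  by congr dvd_in; rewrite eE; ring.
have pi3 : dvd_in O (pi ^+ 2 * pi) (pi ^+ 2 * (b * c * z^-1)).
  have h1 : dvd_in O (pi ^+ 2 * pi) (w ^+ d).
    rewrite -[X in w ^+ X](subnKC d2) exprD; apply: dvd_inMr; first by rewrite rpredX.
    by rewrite -exprSr; apply: dvd_inX.
  have h2 := dvd_in_trans (dvd_in_mul pi2d (dvd_inMl Oa2 piw))
    (freshman_dream pr_d Oa2 Ow).
  have /dvd_inN := dvd_inD h1 h2.
  have -> : a ^+ 2 + w = e by rewrite /w; ring.
  by congr dvd_in; rewrite eE; ring.
have pi20 : pi ^+ 2 != 0 by rewrite expf_neq0.
have pibcz := dvd_in_mul2l pi20 pi3.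
have [h Oh ch] : exists2 h, h \in O & c * h = 1 by apply: periodic_unit cn0.
have Obz : - (b ^+ d.-1 * z * h * h) \in O.
  by rewrite rpredN !rpredM // rpredX.
have := dvd_inMr Obz pibcz.
have -> : b * c * z^-1 * - (b ^+ d.-1 * z * h * h) = 1.
  transitivity (- (b * b ^+ d.-1) * h * (c * h)); first by field.
  by rewrite -exprS prednK // bd opprK ch mulr1.
move=> /(dvd_inX d); rewrite expr1n => /(dvd_in_trans (dvd_root_1BX pr_d zd Oz)).
exact: prime_not_unit.
Qed.
End KummerArithmetic.

(** * Gleason polynomials and Moebius cancellation *)

Section Moebius.

Lemma mobiusM_prime p k : prime p -> (0 < k)%N ->
  mobius (p * k) = if (p %| k)%N then 0 else - mobius k.
Proof.
move=> pr_p k0; have p0 := prime_gt0 pr_p.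
have pk0 : (0 < p * k)%N by rewrite muln_gt0 p0.
case: ifP => [pk | npk].
  rewrite /mobius; case: allP => // /(_ p); rewrite mem_primes pr_p pk0 dvdn_mulr //.
  by move=> /(_ isT); rewrite lognM // logn_prime // eqxx add1n eqSS -leqn0 leqNgt
    logn_gt0 mem_primes pr_p k0 pk.
have perm_pk : perm_eq (primes (p * k)) (p :: primes k).
  apply: uniq_perm; rewrite /= ?primes_uniq ?mem_primes ?pr_p ?k0 ?npk //.
  by move=> q; rewrite primesM // primes_prime // !inE.
rewrite /mobius (perm_size perm_pk) (perm_all _ perm_pk) /= lognM //.
rewrite logn_prime // eqxx lognE pr_p k0 npk addn0 eqxx /=.
have -> : all (fun q => logn q (p * k) == 1%N) (primes k) =
          all (fun q => logn q k == 1%N) (primes k).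
  apply: eq_in_all => q; rewrite mem_primes => /and3P[pr_q _ qk].
  rewrite lognM // logn_prime //; case: (q =P p) qk => [->|//].
  by rewrite npk.
by case: ifP; rewrite ?exprS ?mulN1r ?oppr0.
Qed.

(** The divisors prime to a chosen prime factor [p] of [N] cancel against
    their multiples by [p]. *)
Lemma sum_mobius N : (1 < N)%N -> \sum_(k <- divisors N) mobius k = 0.
Proof.
move=> N1; have N0 := ltnW N1; pose p := pdiv N.
have pr_p : prime p by rewrite pdiv_prime.
have pN : (p %| N)%N by rewrite pdiv_dvd.
have p0 := prime_gt0 pr_p.
rewrite (bigID (fun k => p %| k)%N) /=.
rewrite (bigID (fun k => p %| k %/ p)%N) /= [X in X + _ + _]big1_seq => [|k]; last first.
  rewrite -dvdn_divisors // => /andP[/andP[pk pkp] kN].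
  have k0 : (0 < k %/ p)%N by rewrite divn_gt0 // dvdn_leq // (dvdn_gt0 N0 kN).
  by rewrite -(divnK pk) mulnC mobiusM_prime // pkp.
rewrite add0r.
have perm_p : perm_eq [seq k <- divisors N | (p %| k)%N && ~~ (p %| k %/ p)%N]
    [seq (p * k)%N | k <- divisors N & ~~ (p %| k)%N].
  apply: uniq_perm; first by rewrite filter_uniq ?divisors_uniq.
    rewrite map_inj_uniq ?filter_uniq ?divisors_uniq // => u v /eqP.
    by rewrite eqn_pmul2l // => /eqP.
  move=> k; rewrite mem_filter -dvdn_divisors //; apply/idP/mapP.
    move=> /andP[/andP[pk npk] kN]; exists (k %/ p)%N; last by rewrite mulnC divnK.
    by rewrite mem_filter npk -dvdn_divisors //= (dvdn_trans (dvdn_div pk)).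
  move=> [m]; rewrite mem_filter -dvdn_divisors // => /andP[npm mN] ->.
  by rewrite mulKn // npm dvdn_mulr //= Gauss_dvd ?pN // prime_coprime.
rewrite -big_filter (perm_big _ perm_p) big_map !big_filter /=.
rewrite -big_split /= big1_seq // => k /andP[npk].
rewrite -dvdn_divisors // => kN; rewrite mobiusM_prime ?(dvdn_gt0 N0 kN) //.
by rewrite (negPf npk) addNr.
Qed.

Lemma sum_mobius_multiples j N : (0 < j)%N -> (0 < N)%N -> N <> j ->
  \sum_(k <- divisors N | (j %| k)%N) mobius (N %/ k) = 0.
Proof.
move=> j0 N0 Nj; have [jN | njN] := boolP (j %| N)%N; last first.
  rewrite big1_seq // => k; rewrite -dvdn_divisors // => /andP[jk kN].
  by rewrite (dvdn_trans jk kN) in njN.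
have NJ1 : (1 < N %/ j)%N.
  rewrite ltn_neqAle divn_gt0 // dvdn_leq // andbT eq_sym.
  by apply/eqP => E; apply: Nj; rewrite -(divnK jN) E mul1n.
transitivity (\sum_(k <- divisors (N %/ j)) mobius k); last exact: sum_mobius.
rewrite -big_filter.
have perm_j : perm_eq [seq k <- divisors N | (j %| k)%N]
    [seq (N %/ k)%N | k <- divisors (N %/ j)].
  have NjN : (N %/ j %| N)%N by rewrite dvdn_div.
  have Nj0 := dvdn_gt0 N0 NjN.
  apply: uniq_perm; first by rewrite filter_uniq ?divisors_uniq.
    rewrite map_inj_in_uniq ?divisors_uniq // => u v.
    rewrite -!dvdn_divisors // => uN vN uv.
    have := congr1 (divn N) uv.
    by rewrite !divnA ?(dvdn_trans uN) ?(dvdn_trans vN) // !mulKn.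
  move=> k; rewrite mem_filter -dvdn_divisors //; apply/andP/mapP.
    move=> [jk kN]; exists (N %/ k)%N; last by rewrite divnA // mulKn.
    rewrite -dvdn_divisors // dvdn_divRL // -{2}(divnK kN).
    by rewrite dvdn_mul.
  move=> [m]; rewrite -dvdn_divisors // => mNj ->.
  have mN := dvdn_trans mNj NjN.
  rewrite dvdn_div // dvdn_divRL //; split=> //.
  by move: mNj; rewrite dvdn_divRL // mulnC.
rewrite (perm_big _ perm_j) big_map; apply: eq_big_seq => k.
rewrite -dvdn_divisors 1?ltnW // => kNj; congr mobius.
have kN : (k %| N)%N := dvdn_trans kNj (dvdn_div jN).
by rewrite divnA // mulKn.
Qed.
End Moebius.

Section GleasonRoots.
Variables (R : idomainType) (ev : {rmorphism {poly int} -> R}).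
Variables (d n : nat) (G : {poly int}).
Hypotheses (n0 : (0 < n)%N) (defG : is_gleason_poly d n G).

(** The units of the local ring of Z[X] at the kernel of [ev]. *)
Definition ev_unit (x : {fraction {poly int}}) : Prop :=
  exists N D, [/\ ev N != 0, ev D != 0 & x * tofrac D = tofrac N].

Lemma ev_unit_tofrac P : ev_unit (tofrac P) <-> ev P != 0.
Proof.
split=> [[N [D [N0 D0]]]|P0]; last first.
  by exists P, 1; rewrite rmorph1 oner_neq0 rmorph1 mulr1.
rewrite -rmorphM => /eqP; rewrite tofrac_eq => /eqP PD.
by move: N0; rewrite -PD rmorphM mulf_eq0 negb_or => /andP[].
Qed.

Lemma ev_unitM x y : ev_unit x -> ev_unit y -> ev_unit (x * y).
Proof.
move=> [N [D [N0 D0 xD]]] [M [E [M0 E0 yE]]]; exists (N * M), (D * E).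
by rewrite !rmorphM !mulf_neq0 // mulrACA xD yE.
Qed.

Lemma ev_unitXz x (m : int) : ev_unit x -> ev_unit (x ^ m).
Proof.
have unitX y k : ev_unit y -> ev_unit (y ^+ k).
  move=> uy; elim: k => [|k IHk]; last by rewrite exprS; apply: ev_unitM.
  by rewrite expr0 -tofrac1; apply/ev_unit_tofrac; rewrite rmorph1 oner_neq0.
move=> ux; case: m => k; first exact: unitX.
rewrite -[x ^ Negz k]/(x ^- k.+1); move: (unitX x k.+1 ux) => [N [D [N0 D0 xD]]].
exists D, N; split=> //.
have tN : tofrac N != 0 by rewrite tofrac_eq0; apply: contraNneq N0 => ->; rewrite rmorph0.
have x0 : x ^+ k.+1 != 0 by apply: contraNneq tN => x0; rewrite -xD x0 mul0r.
by rewrite -xD mulKf.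
Qed.

(** The exponent of [Y] in the product defining [G] is the sum of the Moebius
    values [mobius (n %/ k)] over the multiples [k] of [j], that is 0. *)
Lemma gleason_ev_neq0 j (Y : {poly int}) (h : nat -> {poly int}) :
    (0 < j)%N -> n <> j -> Y != 0 ->
    (forall k, (0 < k)%N -> ev (h k) != 0 /\
       crit_poly d k = Y ^+ (j %| k)%N * h k) ->
  ev G != 0.
Proof.
move=> j0 nj Y0 hP; apply/ev_unit_tofrac; rewrite defG.
have tY0 : tofrac Y != 0 by rewrite tofrac_eq0.
have -> : \prod_(k <- divisors n) tofrac (crit_poly d k) ^ mobius (n %/ k) =
    \prod_(k <- divisors n) tofrac (h k) ^ mobius (n %/ k).
  transitivity (tofrac Y ^ (\sum_(k <- divisors n | (j %| k)%N) mobius (n %/ k)) *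
    \prod_(k <- divisors n) tofrac (h k) ^ mobius (n %/ k)); last first.
    by rewrite sum_mobius_multiples // expr0z mul1r.
  rewrite (big_morph (fun m => tofrac Y ^ m) (fun a b => expfzDr a b tY0) (expr0z _)).
  rewrite [X in _ = X * _]big_mkcond -big_split /=; apply: eq_big_seq => k.
  rewrite -dvdn_divisors // => /(dvdn_gt0 n0)/hP[_ ->].
  by rewrite rmorphM rmorphXn expfzMl; case: (j %| k)%N; rewrite ?expr1 ?exp1rz.
rewrite big_seq; apply: (big_ind ev_unit) => [|x y|k].
- by rewrite -tofrac1; apply/ev_unit_tofrac; rewrite rmorph1 oner_neq0.
- exact: ev_unitM.
rewrite -dvdn_divisors // => /(dvdn_gt0 n0)/hP[hk _].
by apply/ev_unitXz/ev_unit_tofrac.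
Qed.

Lemma gleason_root_crit : ev G = 0 ->
  exists k, (k %| n)%N /\ ev (crit_poly d k) = 0.
Proof.
move=> G0; apply: contrapT => noroot.
suff : ev G != 0 by rewrite G0 eqxx.
apply/ev_unit_tofrac; rewrite defG big_seq; apply: (big_ind ev_unit) => [|x y|k].
- by rewrite -tofrac1; apply/ev_unit_tofrac; rewrite rmorph1 oner_neq0.
- exact: ev_unitM.
rewrite -dvdn_divisors // => kn; apply/ev_unitXz/ev_unit_tofrac/eqP => k0.
by apply: noroot; exists k.
Qed.

End GleasonRoots.

Section GleasonParameters.
Variables (F : fieldType) (d n : nat) (c : F) (G : {poly int}).
Hypotheses (pr_d : prime d) (n0 : (0 < n)%N) (defG : is_gleason_poly d n G).
Hypothesis Gc : (map_poly intr G).[c] = 0.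
Let d0 : (0 < d)%N := prime_gt0 pr_d.

Let ev : {rmorphism {poly int} -> F} :=
  (horner_eval c \o map_poly (intr : int -> F)).
Let evX : ev 'X = c.
Proof. by rewrite /= map_polyX /horner_eval hornerX. Qed.
Let evG : ev G = 0. Proof. exact: Gc. Qed.

Lemma gleason_root_periodic : orb d c n = 0.
Proof.
have [k [kn ck]] := gleason_root_crit n0 defG evG.
have {ck}ck : orb d c k = 0.
  by rewrite -crit_polyE //; apply: dvdn_gt0 kn.
move: kn => /dvdnP[m ->]; elim: m => // m IHm.
by rewrite mulSn /orb iterD -/(orb d c (m * k)) IHm.
Qed.

(** The root 0 of [crit_poly d k] is simple for every [k]. *)
Lemma gleason_root_neq0 : (1 < n)%N -> c != 0.
Proof.
move=> n1; apply/eqP => c0; suff : ev G != 0 by rewrite evG eqxx.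
have crit_h k : exists h, (0 < k)%N -> ev h != 0 /\ crit_poly d k = 'X ^+ (1 %| k)%N * h.
  case: k => [|k]; first by exists 0.
  suff [h [h1 hE]] : exists h, ev h = 1 /\ crit_poly d k.+1 = 'X * h.
    by exists h; rewrite h1 oner_neq0 dvd1n expr1.
  elim: k => [|k [h [h1 hE]]]; first by exists 1; rewrite rmorph1 mulr1.
  exists (h * crit_poly d k.+1 ^+ d.-1 + 1); split.
    rewrite rmorphD rmorphM rmorphXn rmorph1 hE rmorphM evX c0 mul0r.
    by rewrite expr0n -(subnKC (prime_gt1 pr_d)) /= mulr0 add0r.
  by rewrite mulrDr mulr1 mulrA -hE -exprS prednK.
have [h hP] := choice crit_h.
by apply: (@gleason_ev_neq0 _ ev d n G n0 defG 1 'X h) => //;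
  [move=> n_1; rewrite n_1 in n1 | rewrite polyX_eq0].
Qed.

(** The root [-1] of [crit_poly 2 k] is simple for every even [k]. *)
Lemma gleason_root_neqN1 : d = 2 -> (2 < n)%N -> c != -1.
Proof.
move=> d_2 n2; apply/eqP => cN1; suff : ev G != 0 by rewrite evG eqxx.
have N10 : -1 != 0 :> F by rewrite oppr_eq0 oner_neq0.
have evY : ev ('X + 1) = 0 by rewrite rmorphD evX rmorph1 cN1 addNr.
have crit_odd_even m : ev (crit_poly 2 m.*2.+1) = -1 /\
    exists2 h, ev h = -1 & crit_poly 2 m.*2.+2 = ('X + 1) * h.
  have E k : crit_poly 2 k.+2 = crit_poly 2 k.+1 ^+ 2 + 'X by [].
  elim: m => [|m [_ [h hN1 hE]]].
    rewrite E -[crit_poly 2 1]/'X evX; split=> //; exists 'X; first by rewrite evX.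
    by ring.
  rewrite doubleS [crit_poly 2 m.*2.+4]E [crit_poly 2 m.*2.+3]E hE; split.
    by rewrite rmorphD rmorphXn rmorphM evY mul0r expr0n evX add0r.
  exists (('X + 1) ^+ 3 * h ^+ 4 + 2%:R * ('X + 1) * h ^+ 2 * 'X + 'X); last by ring.
  rewrite !rmorphD !rmorphM ?rmorphXn evY evX.
  by rewrite !(expr0n, mul0r, mulr0, add0r) cN1.
have crit_h k : exists h, (0 < k)%N ->
    ev h != 0 /\ crit_poly d k = ('X + 1) ^+ (2 %| k)%N * h.
  rewrite d_2 dvdn2; case: k => [|k]; first by exists 0.
  have [odd_k | even_k] := boolP (odd k).
    have [_] := crit_odd_even k./2; have := odd_double_half k.
    rewrite odd_k add1n => kE [h hN1 hE].
    by exists h; rewrite -[in crit_poly _ _]kE hN1 hE /= odd_k.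
  have [kN1 _] := crit_odd_even k./2; have := odd_double_half k.
  rewrite (negPf even_k) add0n => kE; exists (crit_poly 2 k.+1).
  by rewrite -[in ev _]kE kN1 /= even_k mul1r.
have [h hP] := choice crit_h.
apply: (@gleason_ev_neq0 _ ev d n G n0 defG 2 ('X + 1) h) => //.
  by move=> n_2; rewrite n_2 in n2.
by have := polyXsubC_eq0 (-1 : int); rewrite polyCN opprK => ->.
Qed.

End GleasonParameters.

(** * Automorphisms of the tower *)

Section GaloisEmbedding.
Variables (K : fieldType) (L M : splittingFieldType K).
Variable phi : {lrmorphism L -> M}.
Local Notation phiF := (linfun phi).

Let phiFK : cancel phiF (phiF^-1)%VF.
Proof.
by apply: lker0_lfunK; apply/lker0P => x y; rewrite !lfunE; apply: fmorph_inj.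
Qed.

Let limgP y : reflect (exists x, y = phi x) (y \in agenv (phiF @: fullv)).
Proof.
rewrite -(aimg_agen (linfun_ahom phi)) [X in (_ @: X)%VS](subfield_closed (aspacef L)).
apply: (iffP memv_imgP) => [[x _ ->]|[x ->]]; exists x; rewrite ?memvf //.
  by rewrite lfunE.
by rewrite lfunE.
Qed.

(** [t] is a K-embedding of the subfield [phi L] of the normal extension [M]. *)
Lemma gal_lift (t : gal_of {:L}) :
  exists s : gal_of {:M}, forall x, s (phi x) = phi (t x).
Proof.
pose E := agenv_aspace (phiF @: fullv); pose g := (phiF \o t \o phiF^-1)%VF.
have gE x : g (phi x) = phi (t x).
  by rewrite !comp_lfunE -[phi x](lfunE phi) phiFK lfunE.
have khom_g : kHom 1 E g.
  apply/kHomP; split.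
    move=> _ _ /limgP[x ->] /limgP[y ->].
    by rewrite -rmorphM !gE !rmorphM.
  move=> _ /vlineP[a ->].
  by rewrite -(rmorph_alg phi) gE !rmorph_alg.
have [s _ sE] := kHom_to_gal (introT andP (conj (sub1v E) (subvf E)))
  (normalFieldf 1) khom_g.
by exists s => x; rewrite -sE ?gE //; apply/limgP; exists x.
Qed.

(** The image of [L] is normal: it contains the roots of the minimal
    polynomials of its elements, hence their conjugates. *)
Lemma gal_restrict (s : gal_of {:M}) :
  exists t : gal_of {:L}, forall x, s (phi x) = phi (t x).
Proof.
have s_phi x : exists y, s (phi x) = phi y.
  have [r _ Px] := normalFieldP (normalFieldf (1%AS : {subfield L})) x (memvf x).
  have : root (map_poly phi (minPoly 1 x)) (s (phi x)).
    apply: (@kHom_root_id _ M 1 {:M}); rewrite ?subvf ?k1AHom ?memvf //.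
      apply/polyOverP => i; rewrite coef_map /=.
      have /polyOverP/(_ i)/vlineP[a ->] := minPolyOver 1 x.
      have -> : phi a%:A = a%:A by apply: (rmorph_alg phi).
      by rewrite rpredZ // rpred1.
    by rewrite fmorph_root root_minPoly.
  have -> : map_poly phi (minPoly 1 x) = \prod_(y <- map phi r) ('X - y%:P).
    by rewrite Px rmorph_prod big_map; apply: eq_bigr => y _; apply: map_polyXsubC.
  by rewrite root_prod_XsubC => /mapP[y _ ->]; exists y.
pose g := (phiF^-1 \o s \o phiF)%VF.
have gE x : phi (g x) = s (phi x).
  have [y sy] := s_phi x.
  suff -> : g x = y by [].
  by rewrite !comp_lfunE [phiF x]lfunE /= sy -[phi y](lfunE phi) phiFK.
have phi_inj : injective phi by apply: fmorph_inj.
have khom_g : kHom 1 {:L} g.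
  apply/kHomP; split=> [x y _ _|_ /vlineP[a ->]]; apply: phi_inj.
    by rewrite gE !rmorphM /= !gE.
  have phi_a : phi a%:A = a%:A by apply: (rmorph_alg phi).
  by rewrite gE phi_a rmorph_alg.
have [t _ tE] := kHom_to_gal (introT andP (conj (sub1v {:L}) (subvf _)))
  (normalFieldf 1) khom_g.
by exists t => x; rewrite -tE ?memvf ?gE.
Qed.
End GaloisEmbedding.

Section Tower.
Variables (K : fieldType) (f : {poly K}) (alpha : K).
Variable T : preimage_tower f alpha.

(** An automorphism of level [m] is restricted down to level 0 and lifted
    upwards, one level at a time. *)
Lemma arboreal_surjective m (g : gal_of {:T m}) :
  exists s : arboreal_gal T, gal_at s m = g.
Proof.
have [t tP tm] : exists2 t : forall k, gal_of {:T k},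
    forall k, (k < m)%N -> restricts (t k.+1) (t k) & t m = g.
  elim: m g => [|m IHm] g.
    exists (dfwith (T := fun k => gal_of {:T k}) (fun k => 1%g) g) => //.
    by rewrite dfwith_in.
  have [h hg] := gal_restrict (level_emb T m) g.
  have [t tP th] := IHm h.
  exists (dfwith (T := fun k => gal_of {:T k}) t g); last by rewrite dfwith_in.
  move=> k; rewrite ltnS leq_eqVlt => /predU1P[-> | km].
    by rewrite dfwith_in dfwith_out ?gtn_eqF // th.
  by rewrite !dfwith_out ?gtn_eqF ?ltnS ?(ltnW km) //; apply: tP.
have [lift liftP] : exists lift : forall k, gal_of {:T k} -> gal_of {:T k.+1},
    forall k h, restricts (lift k h) h.
  exists (fun k h => sval (cid (gal_lift (level_emb T k) h))) => k h.
  by case: cid.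
pose u := nat_rect (fun k => gal_of {:T k}) (t 0%N)
  (fun k h => if (k < m)%N then t k.+1 else lift k h).
have u_t k : (k <= m)%N -> u k = t k by case: k => //= k ->.
have uP k : restricts (u k.+1) (u k).
  rewrite /=; case: ifP => [km|_]; last exact: liftP.
  by rewrite (u_t k (ltnW km)); apply: tP.
by exists (ArborealGal uP); rewrite /= u_t.
Qed.

Lemma arboreal_abelian : (forall s t : arboreal_gal T, (s * t = t * s)%g) ->
  forall m (g h : gal_of {:T m}), (g * h = h * g)%g.
Proof.
move=> ab m g h; have [s <-] := arboreal_surjective g.
have [t <-] := arboreal_surjective h.
exact: (congr1 (fun r => gal_at r m) (ab s t)).
Qed.
End Tower.

(** * Splitting of iterates *)

Section SplitPolynomials.
Variable L : fieldType.
Implicit Types P Q : {poly L}.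

Definition splits P : Prop := exists rs, P %= \prod_(r <- rs) ('X - r%:P).

Lemma splits_dvd P Q : splits P -> Q %| P -> splits Q.
Proof.
move=> [rs Prs]; rewrite (eqp_dvdr _ Prs) => /dvdp_prod_XsubC[m Qm].
by exists (mask m rs).
Qed.

Lemma splits_root P : splits P -> (1 < size P)%N -> exists y, root P y.
Proof.
move=> [[|r rs] Prs]; first by rewrite (eqp_size Prs) big_nil size_poly1.
by exists r; rewrite (eqp_root Prs) root_prod_XsubC mem_head.
Qed.

Lemma size_exp_gt2 P d : (1 < size P)%N -> (1 < d)%N -> (2 < size (P ^+ d)%R)%N.
Proof.
move=> sP d1; have := size_exp P d; case: (size P) sP => [|[|m]] // _ /= sE.
by case: (size _) sE d1 => [|[|[|s]]] //=; case: d => [|[|e]] //; rewrite mulSn.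
Qed.

(** This is where the roots of unity come from: [P.[y] / b] is a [d]-th root
    of 1 other than 1. The root [y] is taken on the cofactor of [P - b], and
    [P.[y] = b] would make that cofactor equal [d * b ^+ d.-1] at [y]. *)
Lemma splits_other_power P (b : L) d : (1 < d)%N -> d%:R != 0 :> L -> b != 0 ->
    (1 < size P)%N -> splits (P ^+ d - (b ^+ d)%:P) ->
  exists y, P.[y] ^+ d = b ^+ d /\ P.[y] != b.
Proof.
move=> d1 dL b0 sP; rewrite polyC_exp subrXX.
set Q := \sum_(i < d) _ => splPQ.
have sQ : (1 < size Q)%N.
  have E := subrXX P b%:P d.
  have s2 := size_exp_gt2 sP d1.
  have sPb : size (P - b%:P) = size P.
    by rewrite size_polyDl // size_polyN (leq_ltn_trans (size_polyC_leq1 _)).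
  have sPd : size (P ^+ d - b%:P ^+ d) = size (P ^+ d).
    rewrite size_polyDl // size_polyN -polyC_exp.
    by rewrite (leq_ltn_trans (size_polyC_leq1 _)) // ltnW.
  have Q0 : Q != 0.
    by apply: contraTneq s2 => Q0; rewrite -sPd E -/Q Q0 mulr0 size_poly0.
  have Pb0 : P - b%:P != 0 by rewrite -size_poly_gt0 sPb ltnW.
  have := congr1 (fun p : {poly L} => (size p).-1) E.
  rewrite sPd size_mul // -/Q sPb size_exp.
  move: sP; case: (size P) => [|[|u]] // _; rewrite addSn /=.
  move=> uE; rewrite -(ltn_add2l u) -uE.
  apply: (@leq_trans (u.+1 * 2)); last by rewrite leq_mul2l.
  by rewrite muln2 -addnn addn1 -[X in (X < _)%N]addn0 ltn_add2l.
have [y Qy] := splits_root (splits_dvd splPQ (dvdp_mull _ (dvdpp _))) sQ.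
exists y; split.
  apply/eqP; rewrite -subr_eq0; apply/eqP.
  have := congr1 (fun p : {poly L} => p.[y]) (subrXX P b%:P d).
  rewrite -/Q hornerM (rootP Qy) mulr0.
  by rewrite hornerD hornerN !horner_exp hornerC.
apply/eqP => Pyb; move: Qy; rewrite /root horner_sum.
rewrite (eq_bigr (fun=> b ^+ d.-1)) => [|i _].
  rewrite sumr_const card_ord -mulr_natl mulf_eq0 (negPf dL) expf_eq0.
  by rewrite (negPf b0) andbF.
rewrite hornerM !horner_exp hornerC Pyb -exprD; congr (_ ^+ _).
by rewrite subnK // -ltnS prednK ?ltn_ord // ltnW.
Qed.

Lemma poly_iterS (f : {poly L}) k : poly_iter f k.+1 = f \Po poly_iter f k.
Proof. by []. Qed.

Lemma poly_iter_unicriticalS d (c : L) k :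
  poly_iter (unicritical d c) k.+1 = poly_iter (unicritical d c) k ^+ d + c%:P.
Proof. by rewrite poly_iterS /unicritical comp_polyD comp_polyC comp_Xn_poly. Qed.

Lemma size_poly_iter d (c : L) k : (1 < d)%N ->
  (1 < size (poly_iter (unicritical d c) k))%N.
Proof.
move=> d1; elim: k => [|k IHk]; first by rewrite size_polyX.
have s2 := size_exp_gt2 IHk d1.
rewrite poly_iter_unicriticalS size_polyDl ?(ltnW s2) //.
by rewrite (leq_ltn_trans (size_polyC_leq1 _)) // ltnW.
Qed.

Lemma size_poly_iterB d (c a : L) k : (1 < d)%N ->
  (1 < size (poly_iter (unicritical d c) k - a%:P)%R)%N.
Proof.
move=> d1; have s := size_poly_iter c k d1.
by rewrite size_polyDl // size_polyN (leq_ltn_trans (size_polyC_leq1 _)).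
Qed.

(** [orb k - beta] is the value at 0 of [f ^ k - beta], hence up to sign
    the square of the product of one root of each pair of opposite roots. *)
Lemma splits_orb_square (c : L) k beta :
    splits (poly_iter (unicritical 2 c) k.+1 - beta%:P) ->
  exists z, z ^+ 2 = (-1) ^+ (k == 0%N) * (orb 2 c k.+1 - beta).
Proof.
elim: k beta => [|k IHk] beta spl.
  have [y] := splits_root spl (size_poly_iterB _ _ _ (isT : 1 < 2)%N).
  rewrite poly_iter_unicriticalS /root !hornerE => /eqP yE.
  exists y; rewrite expr1 mulN1r orb1 //; apply/eqP; rewrite -subr_eq0 -yE; apply/eqP.
  by rewrite /=; ring.
have [y] := splits_root spl (size_poly_iterB _ _ _ (isT : 1 < 2)%N).
move: spl; rewrite poly_iter_unicriticalS; set p := poly_iter _ k.+1 => spl.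
rewrite /root hornerD hornerN hornerD !hornerC horner_exp => /eqP yE.
pose g := p.[y]; have gE : beta = g ^+ 2 + c.
  by apply/eqP; rewrite eq_sym -subr_eq0; apply/eqP.
have pE : p ^+ 2 + c%:P - beta%:P = (p - g%:P) * (p - (- g)%:P).
  by rewrite gE polyCD polyCN polyC_exp opprK; ring.
rewrite pE in spl.
have [z1 z1E] := IHk _ (splits_dvd spl (dvdp_mulr _ (dvdpp _))).
have [z2 z2E] := IHk _ (splits_dvd spl (dvdp_mull _ (dvdpp _))).
exists (z1 * z2); rewrite exprMn z1E z2E mulrACA -expr2 sqrr_sign expr0 !mul1r.
by rewrite [orb 2 c k.+2]orbS gE; move: (orb _ _ _) => u; ring.
Qed.
End SplitPolynomials.

(** * Abelian extensions *)

Section AbelianExtensions.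
Variables (K : fieldType) (L : splittingFieldType K).
Hypothesis charL : forall m, (m%:R == 0 :> L) = (m == 0%N).

Let galoisL (E : {subfield L}) : galois E {:L}.
Proof.
rewrite /galois subvf normalFieldf andbT /=; apply/separableP => x _.
by apply: pcharf0_separable; apply/pcharf0P => m; rewrite charL.
Qed.

Lemma gal_fixed_subfield (E : {subfield L}) x :
  (forall g : gal_of {:L}, {in E, forall y, g y = y} -> g x = x) -> x \in E.
Proof.
move=> fx; have /galois_fixedField <- := galoisL E.
apply/fixedFieldP; rewrite ?memvf // => g gE; apply: fx => y Ey.
exact: (fixed_gal (subvf E) gE Ey).
Qed.

Lemma gal_fixed_base x :
  (forall g : gal_of {:L}, g x = x) -> exists a : K, x = a%:A.
Proof.
by move=> fx; have /vlineP : x \in 1%AS by apply: gal_fixed_subfield => g _.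
Qed.

Lemma gal_alg (g : gal_of {:L}) (a : K) : g a%:A = a%:A.
Proof. by rewrite rmorph_alg. Qed.

Hypothesis abL : forall g h : gal_of {:L}, (g * h = h * g)%g.

Lemma gal_comm (g h : gal_of {:L}) x : g (h x) = h (g x).
Proof. by rewrite -!galM ?memvf // abL. Qed.

(** Let [b] be a square root of [a - c]. The field contains a square root [z]
    of [orb 2 c m.-1 - b] up to sign. If [s] moves [b], then [z * s z] is a
    square root of [orb 2 c m - a]; an automorphism fixing [b] multiplies [z]
    by a sign, and [s z] by the same sign as the group is abelian. So
    [z * s z] lies in K(b), and either it or its product by [b] is in K. *)
Lemma abelian_quadratic_squares (c a : K) m : (1 < m)%N ->
    splits (poly_iter (unicritical 2 c%:A) m - (a%:A : L)%:P) ->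
  exists x : K, [\/ x ^+ 2 = a - c, x ^+ 2 = orb 2 c m - a
                  | x ^+ 2 = (orb 2 c m - a) * (a - c)].
Proof.
case: m => [|[|m]] // _; set f := unicritical _ _ => spl.
pose p := poly_iter f m.+1.
have pE : poly_iter f m.+2 = p ^+ 2 + (c%:A)%:P by apply: poly_iter_unicriticalS.
have [y] := splits_root spl (size_poly_iterB _ _ _ (isT : 1 < 2)%N).
rewrite pE /root hornerD hornerN hornerD !hornerC horner_exp => /eqP yE.
pose b := p.[y]; have bE : b ^+ 2 = (a - c)%:A.
  by rewrite scalerBl; apply/eqP; rewrite -subr_eq0 -yE; apply/eqP; rewrite /b; ring.
have orbA k : orb 2 (c%:A : L) k = (orb 2 c k)%:A.
  elim: k => [|k IHk]; first by rewrite /= scale0r.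
  by rewrite !orbS IHk -[_%:A ^+ 2](rmorphXn (in_alg L)) scalerDl.
have ppE : p ^+ 2 + (c%:A)%:P - (a%:A)%:P = (p - b%:P) * (p - (- b)%:P).
  have -> : a%:A = b ^+ 2 + c%:A by rewrite bE scalerBl subrK.
  by rewrite polyCD polyCN polyC_exp opprK; ring.
rewrite pE ppE in spl.
have [z zE] := splits_orb_square (splits_dvd spl (dvdp_mulr _ (dvdpp _))).
have sqr_sign (u v : L) : u ^+ 2 = v ^+ 2 -> u = v \/ u = - v.
  by move/eqP; rewrite eqf_sqr => /orP[/eqP|/eqP]; [left | right].
have gb (g : gal_of {:L}) : g b = b \/ g b = - b.
  by apply: sqr_sign; rewrite -rmorphXn /= bE gal_alg.
have [all_b | ] := pselect (forall g : gal_of {:L}, g b = b).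
  have [x xE] := gal_fixed_base all_b; exists x; apply: Or31.
  apply: (fmorph_inj (in_alg L)); rewrite rmorphXn /=.
  by rewrite -xE bE.
move=> /existsNP[s sb]; have {}sb : s b = - b by case: (gb s).
have gz (g : gal_of {:L}) : g b = b -> g (z * s z) = z * s z.
  move=> gbb; rewrite rmorphM /= (gal_comm g s).
  have /sqr_sign[-> //|->] : (g z) ^+ 2 = z ^+ 2; last by rewrite rmorphN mulrNN.
  by rewrite -rmorphXn /= zE rmorphM rmorphB /= gbb orbA gal_alg rmorphXn rmorphN1.
have Y2 : (z * s z) ^+ 2 = (orb 2 c m.+2 - a)%:A.
  rewrite exprMn -rmorphXn /= zE rmorphM rmorphB /= sb orbA gal_alg rmorphXn rmorphN1.
  rewrite mulrACA -expr2 sqrr_sign mul1r [orb 2 c m.+2]orbS.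
  move: (orb 2 c m.+1) => u; rewrite scalerBl scalerDl.
  have -> : a%:A = b ^+ 2 + c%:A by rewrite bE scalerBl subrK.
  have -> : (u ^+ 2)%:A = u%:A ^+ 2 :> L.
    by rewrite -[RHS](rmorphXn (in_alg L)).
  by ring.
have fix_s (x : L) : s x = x -> (forall g : gal_of {:L}, g b = b -> g x = x) ->
    exists u : K, x = u%:A.
  move=> sx gx; apply: gal_fixed_base => g; case: (gb g) => [/gx //|gNb].
  rewrite -{1}sx -galM ?memvf // gx // galM ?memvf //.
  by rewrite sb rmorphN /= gNb opprK.
have Yb2 : (z * s z * b) ^+ 2 = ((orb 2 c m.+2 - a) * (a - c))%:A.
  by rewrite exprMn Y2 bE -[LHS](rmorphM (in_alg L)).
have /sqr_sign[sY|sY] : s (z * s z) ^+ 2 = (z * s z) ^+ 2.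
  by rewrite -rmorphXn /= Y2 gal_alg.
- have [x xE] := fix_s _ sY gz; exists x; apply: Or32.
  by apply: (fmorph_inj (in_alg L)); rewrite rmorphXn /= -xE Y2.
have sYb : s (z * s z * b) = z * s z * b by rewrite rmorphM /= sY sb mulrNN.
have gYb (g : gal_of {:L}) : g b = b -> g (z * s z * b) = z * s z * b.
  by move=> gbb; rewrite rmorphM /= gz // gbb.
have [x xE] := fix_s _ sYb gYb; exists x; apply: Or33.
by apply: (fmorph_inj (in_alg L)); rewrite rmorphXn /= -xE Yb2.
Qed.

(** An element moving the root of unity [z] would fix one of the [d]-th roots
    of [a]; it commutes with the automorphisms moving this root, so it would
    fix a nontrivial ratio of two roots, and [z] is a power of that ratio. *)
Lemma abelian_root_of_unity d (a : K) (beta z : L) : prime d ->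
    beta ^+ d = a%:A -> (forall x : K, x ^+ d <> a) ->
    z ^+ d = 1 -> z != 1 ->
  exists x : K, z = x%:A.
Proof.
move=> pr_d betad a_pow zd z1; apply: gal_fixed_base => s.
apply/eqP/negPn/negP => sz.
have d0 := prime_gt0 pr_d.
have z0 : z != 0.
  by apply: contra_eq_neq zd => ->; rewrite expr0n eqn0Ngt d0 eq_sym oner_eq0.
have move_root (y : L) : y ^+ d = a%:A -> exists g : gal_of {:L}, g y != y.
  move=> yd; apply: contrapT => nog.
  have [x yx] : exists x : K, y = x%:A.
    by apply: gal_fixed_base => g; apply/eqP/negPn/negP => gy; apply: nog; exists g.
  apply: (a_pow x); apply: (fmorph_inj (in_alg L)).
  by rewrite rmorphXn /= -yx.
have root_neq0 (y : L) : y ^+ d = a%:A -> y != 0.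
  move=> yd; apply/eqP => y0; apply: (a_pow 0).
  apply: (fmorph_inj (in_alg L)).
  by rewrite rmorphXn rmorph0 /=; move: yd; rewrite y0.
have ratio (g : gal_of {:L}) (y : L) : y ^+ d = a%:A -> (g y / y) ^+ d = 1.
  move=> yd; have ad0 : a%:A != 0 :> L by rewrite -yd expf_neq0 ?root_neq0.
  by rewrite exprMn exprVn -rmorphXn /= yd gal_alg divff.
have prz2 : d.-primitive_root (s z / z).
  apply: prime_primitive_root => //.
    by rewrite exprMn exprVn -rmorphXn /= zd rmorph1 mul1r invr1.
  by apply: contra_neq sz => szz; rewrite -[LHS](divfK z0) szz mul1r.
have [l lE] : exists l : nat, (s beta / beta)^-1 = (s z / z) ^+ l.
  have h : (s beta / beta)^-1 ^+ d = 1 by rewrite exprVn ratio ?invr1.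
  by have [i iE] := prim_rootP prz2 h; exists i.
(* The exponent [l] is chosen to make [beta'] a fixed point of [s]. *)
pose beta' := z ^+ l * beta.
have beta'd : beta' ^+ d = a%:A.
  by rewrite exprMn exprAC zd expr1n mul1r.
have s_beta' : s beta' = beta'.
  have b0 := root_neq0 _ betad.
  have sz0 : s z != 0 by rewrite fmorph_eq0.
  have sb0 : s beta != 0 by rewrite fmorph_eq0.
  rewrite rmorphM rmorphXn /= /beta'.
  have -> : s beta = (s beta / beta) * beta by rewrite divfK.
  rewrite -[s beta / beta]invrK lE expr_div_n invf_div.
  by field; rewrite !expf_neq0.
have [g gb] := move_root _ beta'd.
have b'0 := root_neq0 _ beta'd.
have s_ratio : s (g beta' / beta') = g beta' / beta'.
  by rewrite rmorphM fmorphV /= gal_comm s_beta'.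
have prg : d.-primitive_root (g beta' / beta').
  apply: prime_primitive_root => //; first exact: ratio.
  by apply: contra_neq gb => gbb; rewrite -[LHS](divfK b'0) gbb mul1r.
have [i iE] := prim_rootP prg zd.
by move/eqP: sz; rewrite iE rmorphXn /= s_ratio.
Qed.

(** An automorphism [g] fixing [z] multiplies [beta] by a power of [z]; as [g]
    commutes with [t], it multiplies [t beta] by the inverse of that power. *)
Lemma abelian_kummer d (beta z : L) (t : gal_of {:L}) :
    prime d -> z ^+ d = 1 -> z != 1 -> t z = z^-1 ->
    beta ^+ d \in <<1; z>>%VS -> beta * t beta \in <<1; z>>%VS.
Proof.
move=> pr_d zd z1 tz betad; apply: gal_fixed_subfield => g gE.
have [-> | b0] := eqVneq beta 0; first by rewrite !(rmorph0, mul0r).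
have prz := prime_primitive_root pr_d zd z1.
have z0 : z != 0.
  by apply: contra_eq_neq zd => ->; rewrite expr0n eqn0Ngt prime_gt0 // eq_sym oner_eq0.
have gz : g z = z by apply: gE; apply: memv_adjoin.
have wd : (g beta / beta) ^+ d = 1.
  by rewrite exprMn exprVn -rmorphXn /= gE // divff // expf_neq0.
have [i iE] := prim_rootP prz wd.
have gb : g beta = z ^+ i * beta by rewrite -iE divfK.
rewrite rmorphM /= gal_comm gb rmorphM rmorphXn /= tz mulrACA -exprMn divff //.
by rewrite expr1n mul1r.
Qed.

End AbelianExtensions.

(** * Number fields *)

Section NumberField.

Lemma has_denominatorD (F : fieldType) gens (x y : F) :
  has_denominator gens x -> has_denominator gens y -> has_denominator gens (x + y).
Proof.
move=> dx dy; rewrite -[y]opprK -[- y]sub0r; apply: has_denominatorB => //.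
by apply: has_denominatorB => //; apply: has_denominator_in; rewrite rpred0.
Qed.

Lemma has_denominator_horner (F : fieldType) gens (p : {poly F}) z :
    (forall i, has_denominator gens p`_i) -> has_denominator gens z ->
  has_denominator gens p.[z].
Proof.
move=> dp dz; rewrite horner_coef; apply: big_ind => [|x y|i _].
- by apply: has_denominator_in; rewrite rpred0.
- exact: has_denominatorD.
apply: has_denominatorM => //; elim: (i : nat) => [|k IHk].
  by apply: has_denominator_in; rewrite rpred1.
by rewrite exprS; apply: has_denominatorM.
Qed.

Lemma has_denominatorS (F : fieldType) (s t : seq F) x : {subset s <= t} ->
  has_denominator s x -> has_denominator t x.
Proof.
move=> st [N N0 Nx]; exists N => //; apply: subring_gen_sub Nx => y sy.
by rewrite mem_subring_gen ?st.
Qed.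

Lemma has_denominator_map (F E : fieldType) (f : {rmorphism F -> E}) gens x :
  has_denominator gens x -> has_denominator (map f gens) (f x).
Proof.
move=> [N N0 /subring_genP Nx]; exists N => //.
rewrite -(rmorph_nat f) -rmorphM; apply/subring_genP.
elim: Nx => [|y gy|y z _ gy _ gz|y z _ gy _ gz].
- by rewrite rmorph1; apply: Generated1.
- by apply/GeneratedIn/map_f.
- by rewrite rmorphB; apply: GeneratedB.
- by rewrite rmorphM; apply: GeneratedM.
Qed.

Lemma has_denominator_rat (F : fieldExtType rat) gens (a : rat) :
  has_denominator gens (a%:A : F).
Proof.
exists `|denq a|%N; first by rewrite absz_gt0 denq_neq0.
have -> : `|denq a|%N%:R * a%:A = (numq a)%:~R :> F.
  have E : `|denq a|%N%:R * a = (numq a)%:~R by rewrite numqE mulrC pmulrn absz_denq.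
  by rewrite -(rmorph_int (in_alg F)) -E rmorphM rmorph_nat.
by rewrite rpred_int.
Qed.

Variables (K : fieldExtType rat) (c : K).
Hypothesis Kc : <<1; c>>%VS = {:K}%VS.

Lemma field_char0 m : (m%:R == 0 :> K) = (m == 0%N).
Proof.
have := pcharf0P K; case=> h _; apply: h => p; rewrite pchar_lalg.
exact: Num.Theory.pchar_num.
Qed.

Lemma ext_char0 (L : fieldExtType K) m : (m%:R == 0 :> L) = (m == 0%N).
Proof. by rewrite -field_char0 -(rmorph_nat (in_alg L)) fmorph_eq0. Qed.

Lemma number_field_denominator x : has_denominator [:: c] x.
Proof.
have : x \in <<1; c>>%VS by rewrite Kc memvf.
move=> /Fadjoin_polyP[p p1 ->]; apply: has_denominator_horner => [i|].
  have /polyOverP/(_ i)/vlineP[a ->] := p1; exact: has_denominator_rat.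
by apply/has_denominator_in/mem_subring_gen; rewrite mem_head.
Qed.

Lemma base_denominator (L : fieldExtType K) (x : K) :
  has_denominator [:: c%:A] (x%:A : L).
Proof. exact: (has_denominator_map (in_alg L) (number_field_denominator x)). Qed.

Lemma adjoin_denominator (L : fieldExtType K) (z e : L) :
  e \in <<1; z>>%VS -> has_denominator [:: c%:A; z] e.
Proof.
move=> /Fadjoin_polyP[p p1 ->]; apply: has_denominator_horner => [i|].
  have /polyOverP/(_ i)/vlineP[a ->] := p1.
  apply: has_denominatorS (base_denominator L a) => y.
  by rewrite !inE => /eqP->; rewrite eqxx.
by apply/has_denominator_in/mem_subring_gen; rewrite !inE eqxx orbT.
Qed.

Lemma orb_alg (L : fieldExtType K) d k : orb d (c%:A : L) k = (orb d c k)%:A.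
Proof.
elim: k => [|k IHk]; first by rewrite [RHS](rmorph0 (in_alg L)).
by rewrite !orbS IHk -[_%:A ^+ d](rmorphXn (in_alg L)) -[LHS](rmorphD (in_alg L)).
Qed.
End NumberField.

(** * Prime ideals of the ring of integers *)

Section PrimeIdeals.
Variables (K : fieldExtType rat) (d q : nat).
Local Notation OK := (ring_of_integers K).
Variable P : prime_idealr OK.
Hypotheses (q1 : (1 < q)%N) (Pd : d%:R \in P) (dK : d%:R != 0 :> K).
Hypothesis frobK : forall x : OK, exists y : OK, x ^+ q - x = d%:R * y.
Implicit Types (x y u : OK).

Let PX x k : x \in P -> x ^+ k.+1 \in P.
Proof. by move=> Px; rewrite exprSr idealMr. Qed.

Let qE : q = q.-2.+2.
Proof. by case: (q) q1 => [|[]]. Qed.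

Let P1 : 1 \notin P.
Proof. by rewrite idealr1. Qed.

Lemma ideal_pow0 k : ideal_pow P k 0.
Proof. by case: k => // k; exists [::]; rewrite ?big_nil. Qed.

Lemma ideal_powD k x y : ideal_pow P k x -> ideal_pow P k y -> ideal_pow P k (x + y).
Proof.
case: k => // k [r rP ->] [s sP ->]; exists (r ++ s); last by rewrite big_cat.
by move=> u; rewrite mem_cat => /orP[/rP|/sP].
Qed.

Lemma ideal_powMl k x y : ideal_pow P k y -> ideal_pow P k (x * y).
Proof.
case: k => // k [s sP ->]; exists [seq (x * v.1, v.2) | v <- s].
  by move=> _ /mapP[v /sP[Pv kv] ->]; rewrite idealMr.
by rewrite big_map mulr_sumr; apply: eq_bigr => v _; rewrite mulrA.
Qed.

Lemma ideal_pow_mulP k x y : x \in P -> ideal_pow P k y -> ideal_pow P k.+1 (x * y).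
Proof.
move=> Px ky; exists [:: (x, y)]; last by rewrite big_seq1.
by move=> u; rewrite inE => /eqP->.
Qed.

Lemma ideal_powS k x : ideal_pow P k.+1 x -> ideal_pow P k x.
Proof.
move=> [s sP ->]; rewrite big_seq; apply: big_ind => [|y z|v /sP[_ kv]].
- exact: ideal_pow0.
- exact: ideal_powD.
- exact: ideal_powMl.
Qed.

Lemma ideal_pow_le j k x : (j <= k)%N -> ideal_pow P k x -> ideal_pow P j x.
Proof.
move=> jk; rewrite -(subnK jk); elim: (k - j)%N => // i IHi.
by rewrite addSn => /ideal_powS/IHi.
Qed.

(** [u] is invertible modulo [P], hence modulo every power of [P]. *)
Lemma ideal_pow_local k x u : u \notin P -> ideal_pow P k (u * x) -> ideal_pow P k x.
Proof.
move=> uP kux; suff : forall j, (j <= k)%N -> ideal_pow P j x by apply.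
elim=> // j IHj jk.
have Pp : 1 - u ^+ q.-1 \in P.
  have : u * (1 - u ^+ q.-1) \in P.
    have [t tE] := frobK u.
    have -> : u * (1 - u ^+ q.-1) = - t * d%:R.
      by transitivity (- (u ^+ q - u)); [rewrite qE /= !exprS; ring | rewrite tE; ring].
    by rewrite idealMr.
  by rewrite prime_idealrM (negPf uP).
have -> : x = u ^+ q.-2 * (u * x) + (1 - u ^+ q.-1) * x.
  by rewrite qE /= exprS; ring.
apply: ideal_powD; last by apply: ideal_pow_mulP => //; apply: IHj; apply: ltnW.
by apply/ideal_powMl/(ideal_pow_le jk).
Qed.

(** The prime [P] is unramified over [d]: an element [a] of [P] becomes a
    multiple of [d] after multiplication by [1 - a ^+ q.-1], which is not
    in [P]. *)
Lemma ideal_pow_uniformizer k x : ideal_pow P k x ->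
  exists u y, u \notin P /\ u * x = d%:R ^+ k * y.
Proof.
elim: k x => [|k IHk] x /=.
  by exists 1, x; rewrite expr0.
move=> [s sP ->]; elim: s sP => [|[a b] s IHs] sP.
  by exists 1, 0; rewrite big_nil !mulr0.
have [u [y [uP uy]]] : exists u y, u \notin P /\
    u * (\sum_(v <- s) v.1 * v.2) = d%:R ^+ k.+1 * y.
  by apply: IHs => v vs; apply: sP; rewrite inE vs orbT.
have [/= Pa /IHk[w [z [wP wz]]]] := sP _ (mem_head _ _).
have [t tE] := frobK a.
exists (u * ((1 - a ^+ q.-1) * w)), (u * (- t) * z + (1 - a ^+ q.-1) * w * y).
split.
  rewrite !prime_idealrM (negPf uP) (negPf wP) orbF /=.
  apply: contra P1 => Pa1; rewrite -[1](subrK (a ^+ q.-1)) rpredD //.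
  by rewrite qE; apply: PX.
rewrite big_cons /= mulrDr.
have -> : u * ((1 - a ^+ q.-1) * w) * (a * b) = u * (a - a ^+ q) * (w * b).
  by rewrite qE /= !exprS; ring.
have -> : a - a ^+ q = - (d%:R * t) by rewrite -tE opprB.
transitivity (u * - (d%:R * t) * (w * b) +
  (1 - a ^+ q.-1) * w * (u * \sum_(v <- s) v.1 * v.2)); first by ring.
by rewrite wz uy exprS; ring.
Qed.

(** So [d] is a uniformizer at [P], and [P]-adic orders are [d]-adic ones. *)
Lemma exact_pow_uniformizer k x : exact_pow P x k ->
  exists u y, [/\ u \notin P, y \notin P & u * x = d%:R ^+ k * y].
Proof.
move=> [/ideal_pow_uniformizer[u [y [uP uy]]] xk]; exists u, y; split=> //.
apply/negP => Py; apply: xk; apply: (ideal_pow_local uP).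
rewrite uy mulrC; apply: ideal_pow_mulP => //.
elim: (k) => // j IHj; rewrite exprS; exact: ideal_pow_mulP.
Qed.

Lemma padic_val1_simple_at alpha : padic_val P alpha 1 ->
  exists Q, simple_at d Q alpha.
Proof.
move=> [a [b [i [j [ai bj ab ij]]]]].
have {ij} iE : i = j.+1.
  by move/eqP: ij; rewrite eq_sym subr_eq => /eqP[]; rewrite add1n.
have [u [y [uP yP uy]]] := exact_pow_uniformizer ai.
have [v [z [vP zP vz]]] := exact_pow_uniformizer bj.
have memO x : (val x : K) \in integral_elt K.
  by case: x => x /= Ox; move: Ox; rewrite !inE.
have toO (x : K) : x \in integral_elt K -> exists o : OK, val o = x.
  move=> Ox; have Ox' : x \in @algebraic_integer K by move: Ox; rewrite !inE.
  by exists (RingOfIntegers Ox').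
exists (fun x : K => exists2 o : OK, o \in P & val o = x); split.
- move=> _ /toO[o <-]; exists (o * d%:R); first by rewrite idealMr.
  by rewrite rmorphM rmorph_nat mulrC.
- move=> _ _ /toO[o <-] /toO[p <-] [w Pw]; rewrite -rmorphM => /val_inj wE.
  move: Pw; rewrite wE prime_idealrM => /orP[Po|Pp]; [left | right].
    by exists o.
  by exists p.
- move=> [o Po o1]; have oE : o = 1 by apply: val_inj; rewrite o1 rmorph1.
  by move: P1; rewrite -oE Po.
have notQ x : x \notin P -> ~ exists2 o : OK, o \in P & val o = val x.
  by move=> xP [o Po /val_inj ox]; rewrite -ox Po in xP.
exists (val (u * z)), (val (v * y)); split; rewrite ?memO //.
- by apply: notQ; rewrite prime_idealrM negb_or uP.
- by apply: notQ; rewrite prime_idealrM negb_or vP.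
have dj : d%:R ^+ j != 0 :> K by rewrite expf_neq0.
apply: (mulfI dj).
have dX k : oint_val (d%:R ^+ k : OK) = d%:R ^+ k.
  by rewrite -[LHS]/(val _) rmorphXn rmorph_nat.
have {}uy : oint_val u * oint_val a = d%:R ^+ i * oint_val y.
  by have := congr1 val uy; rewrite !rmorphM /= dX.
have {}vz : oint_val v * oint_val b = d%:R ^+ j * oint_val z.
  by have := congr1 val vz; rewrite !rmorphM /= dX.
rewrite !rmorphM /=.
transitivity (alpha * oint_val u * (d%:R ^+ j * oint_val z)); first by ring.
rewrite -vz.
transitivity (oint_val v * (oint_val u * (alpha * oint_val b))); first by ring.
by rewrite ab uy iE exprS; ring.
Qed.

End PrimeIdeals.

(** * Conjugate roots of unity *)

Section CyclotomicInversion.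

Lemma prod_root_1B (F : fieldType) (d : nat) (p : {poly F}) (rs : seq F) x :
    (0 < d)%N -> {in rs, forall r, r ^+ d = 1} -> p \is monic ->
    p %| \prod_(r <- rs) ('X - r%:P) -> root p x ->
  exists2 y, y \in integral_elt F & p.[1] = (1 - x) * y.
Proof.
move=> d0 rsd monp /dvdp_prod_XsubC[m].
rewrite eqp_monic ?monic_prod_XsubC // => /eqP-> .
rewrite root_prod_XsubC => xm.
exists (\prod_(r <- rem x (mask m rs)) (1 - r)); last first.
  rewrite horner_prod (perm_big _ (perm_to_rem xm)) big_cons !hornerE.
  by congr (_ * _); apply: eq_bigr => r _; rewrite !hornerE.
rewrite big_seq rpred_prod // => r /mem_rem/mem_mask/rsd rd.
by rewrite rpredB ?rpred1 // (@integral_elt_root F d) // rd rpred1.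
Qed.

Variables (K : fieldExtType rat) (L : splittingFieldType K) (d n : nat) (c : K).
Hypothesis Kc : <<1; c>>%VS = {:K}%VS.
Hypothesis pr_d : prime d.
Hypotheses (n0 : (0 < n)%N) (cn0 : orb d c n = 0).

(** Otherwise the cyclotomic polynomial splits over K into two factors whose
    values at 1 are both divisible by [d], as [d] is unramified in K; but the
    product of these values is [d]. *)
Lemma cyclotomic_inversion (z : L) : z ^+ d = 1 -> z != 1 ->
  exists t : gal_of {:L}, t z = z^-1.
Proof.
move=> zd z1; have d0 := prime_gt0 pr_d.
have charL m := ext_char0 L m.
have cLn0 : orb d (c%:A : L) n = 0 by rewrite orb_alg cn0 scale0r.
pose Phi : {poly L} := \sum_(i < d) 'X^i.
have PhiE : Phi = \prod_(r <- [seq z ^+ i | i <- index_iota 1 d]) ('X - r%:P).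
  by rewrite big_map; apply: sum_Xn_factor.
have rsd : {in [seq z ^+ i | i <- index_iota 1 d], forall r, r ^+ d = 1}.
  by move=> _ /mapP[i _ ->]; rewrite exprAC zd expr1n.
have monPhi : Phi \is monic by rewrite PhiE monic_prod_XsubC.
have root_pow i : (0 < i < d)%N -> root Phi (z ^+ i).
  move=> id; rewrite PhiE root_prod_XsubC; apply/mapP; exists i => //.
  by rewrite mem_index_iota.
have Phi1 : Phi.[1] = d%:R.
  rewrite horner_sum (eq_bigr (fun=> 1)) => [|i _]; first by rewrite sumr_const card_ord.
  by rewrite hornerXn expr1n.
have PhiK : Phi \is a polyOver 1%VS.
  by apply: rpred_sum => i _; rewrite rpredX // polyOverX.
pose p := minPoly 1 z.
have p_Phi : p %| Phi.
  by apply: minPoly_dvdp => //; rewrite -[z]expr1; apply: root_pow; rewrite prime_gt1.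
have [pzi | npzi] := boolP (root p z^-1).
  have [t _ tz] := normalField_root_minPoly (sub1v _) (normalFieldf _) (memvf z) pzi.
  by exists t.
have monp : p \is monic by apply: monic_minPoly.
have [q qE] : exists q, Phi = q * p by exists (Phi %/ p); rewrite divpK.
have monq : q \is monic by rewrite -(monicMr _ monp) -qE.
have ziE : z^-1 = z ^+ d.-1.
  have z0 : z != 0.
    by apply: contra_eq_neq zd => ->; rewrite expr0n eqn0Ngt d0 eq_sym oner_eq0.
  by apply: (mulfI z0); rewrite mulfV // -exprS prednK.
have qzi : root q z^-1.
  have : root Phi z^-1.
    rewrite ziE; apply: root_pow; rewrite prednK // leqnn andbT.
    by rewrite -ltnS prednK // prime_gt1.
  by rewrite qE rootM (negPf npzi) orbF.
have zid : (z^-1) ^+ d = 1 by rewrite exprVn zd invr1.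
have [y Oy p1] : exists2 y, y \in integral_elt L & p.[1] = (1 - z) * y.
  by apply: (prod_root_1B d0 rsd) => //; [rewrite -PhiE | apply: root_minPoly].
have [w Ow q1] : exists2 w, w \in integral_elt L & q.[1] = (1 - z^-1) * w.
  by apply: (prod_root_1B d0 rsd) => //; rewrite -PhiE qE dvdp_mulr.
have pq1 : q.[1] * p.[1] = d%:R by rewrite -Phi1 qE hornerM.
have dL0 : d%:R != 0 :> L by rewrite charL -lt0n.
have [u pu] : exists u : K, p.[1] = u%:A.
  have /vlineP[u uE] : p.[1] \in 1%VS.
    by rewrite rpred_horner ?rpred1 // minPolyOver.
  by exists u.
have [v qv] : exists v : K, q.[1] = v%:A.
  exists (d%:R / u); have u0 : u%:A != 0 :> L.
    by rewrite -pu; apply: contraNneq dL0 => p10; rewrite -pq1 p10 mulr0.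
  apply: (mulIf u0); rewrite -{1}pu pq1 -[RHS](rmorphM (in_alg L)) /=.
  have u0' : u != 0 by apply: contraNneq u0 => ->; rewrite scale0r.
  by rewrite divfK // -(rmorph_nat (in_alg L)).
have dp : dvd_in (integral_elt L) d%:R p.[1].
  apply: (dvd_root_1B charL pr_d n0 cLn0 _ Oy zd p1).
  by rewrite pu; apply: base_denominator.
have dq : dvd_in (integral_elt L) d%:R q.[1].
  apply: (dvd_root_1B charL pr_d n0 cLn0 _ Ow zid q1).
  by rewrite qv; apply: base_denominator.
have := dvd_in_mul dq dp; rewrite pq1 -[X in dvd_in _ _ X]mulr1.
by move=> /(dvd_in_mul2l dL0)/(prime_not_unit charL pr_d).
Qed.

End CyclotomicInversion.

(** * Arboreal groups *)

Section ArborealGroups.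

Lemma map_poly_iter (K : fieldType) (L : fieldExtType K) d (c : K) m :
  map_poly (in_alg L) (poly_iter (unicritical d c) m) =
  poly_iter (unicritical d (c%:A : L)) m.
Proof.
elim: m => [|m IHm]; first by rewrite map_polyX.
by rewrite !poly_iter_unicriticalS rmorphD rmorphXn /= IHm map_polyC.
Qed.

Lemma level_splits (K : fieldType) d (c alpha : K)
    (T : preimage_tower (unicritical d c) alpha) m :
  splits (poly_iter (unicritical d (c%:A : T m)) m - (alpha%:A : T m)%:P).
Proof.
have [rs rsP _] := level_split T m.
by exists rs; rewrite -map_poly_iter -[(alpha%:A)%:P](map_polyC (in_alg (T m))) -rmorphB.
Qed.

Variables (K : fieldExtType rat) (d n : nat) (c alpha : K).
Variable T : preimage_tower (unicritical d c) alpha.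
Hypothesis Kc : <<1; c>>%VS = {:K}%VS.
Hypotheses (pr_d : prime d) (n0 : (0 < n)%N) (cn0 : orb d c n = 0).
Hypothesis abT : forall m (g h : gal_of {:T m}), (g * h = h * g)%g.

Let charK := @field_char0 K.
Let charT m := ext_char0 (T m).
Let den := number_field_denominator Kc.
Let d0 := prime_gt0 pr_d.
Let d1 := prime_gt1 pr_d.

Lemma exists_simple_at (P : prime_idealr (ring_of_integers K)) :
  d%:R \in P -> padic_val P alpha 1 -> exists Q, simple_at d Q alpha.
Proof.
move=> Pd; apply: (@padic_val1_simple_at K d (d ^ n) P) => //.
- by rewrite -(exp1n n) ltn_exp2r.
- by rewrite charK -lt0n.
move=> x; have Ox : val x \in integral_elt K.
  by case: x => x /= Ox; move: Ox; rewrite !inE.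
have [y Oy xy] := unramified_frobenius charK pr_d n0 cn0 Ox (den _).
have Oy' : y \in @algebraic_integer K by move: Oy; rewrite !inE.
exists (RingOfIntegers Oy'); apply: val_inj.
by rewrite rmorphB rmorphXn rmorphM rmorph_nat xy.
Qed.

(** At level 1 the tower is generated by a [d]-th root and a nontrivial [d]-th
    root of unity; if it were abelian, the latter would be in K. *)
Lemma odd_simple_nonabelian (Q : K -> Prop) : (2 < d)%N -> simple_at d Q alpha ->
  False.
Proof.
move=> d2 Qalpha.
have no_pow x : x ^+ d <> alpha - c.
  exact: (simple_at_not_power charK pr_d n0 cn0 Qalpha).
have spl := level_splits T 1.
have [y] := splits_root spl (size_poly_iterB _ _ _ d1).
rewrite poly_iter_unicriticalS in spl *.
rewrite /root !hornerD hornerN hornerXn !hornerC => /eqP yE.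
have yd : y ^+ d = (alpha - c)%:A.
  by rewrite scalerBl; apply/eqP; rewrite -subr_eq0 -yE; apply/eqP; ring.
have splE : 'X^d + (c%:A)%:P - (alpha%:A)%:P = 'X^d - (y ^+ d)%:P :> {poly T 1}.
  by rewrite yd scalerBl polyCB; ring.
have y0 : y != 0.
  apply/eqP => y0; apply: (no_pow 0); apply: (fmorph_inj (in_alg (T 1))).
  by rewrite rmorphXn rmorph0 /= -yd y0.
have [y' [y'd y'y]] : exists y', ('X : {poly T 1}).[y'] ^+ d = y ^+ d /\ 'X.[y'] != y.
  apply: splits_other_power => //; first by rewrite charT -lt0n.
    by rewrite size_polyX.
  by rewrite -splE.
rewrite hornerX in y'd y'y.
have zd : (y' / y) ^+ d = 1 by rewrite expr_div_n y'd divff // expf_neq0.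
have z1 : y' / y != 1.
  by apply: contra_neq y'y => yy; rewrite -[LHS](divfK y0) yy mul1r.
have [x zx] := abelian_root_of_unity (@charT 1) (@abT 1) pr_d yd no_pow zd z1.
have xd : x ^+ d = 1.
  apply: (fmorph_inj (in_alg (T 1))); rewrite rmorphXn rmorph1 /=.
  by rewrite -zx.
have x1 := no_root_of_unity charK pr_d n0 cn0 d2 (den x) xd.
by move: z1; rewrite zx x1 scale1r eqxx.
Qed.

(** The roots of [f] are the multiples of [b] by [d]-th roots of unity, and
    level 2 contains a [d]-th root [y] of [z * b - c]. If [t] inverts [z],
    the product [y * t y] would contradict [kummer_not_power]. *)
Lemma odd_zero_nonabelian : (2 < d)%N -> (1 < n)%N -> c != 0 -> alpha = 0 -> False.
Proof.
move=> d2 n1 c0 alpha0.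
have alphaA (L : fieldExtType K) : alpha%:A = 0 :> L by rewrite alpha0 scale0r.
pose b := orb d c n.-1.
have bd : b ^+ d = - c by apply/eqP; rewrite -addr_eq0 -orbS prednK // cn0.
have b0 : b != 0.
  by apply: contraNneq c0 => b0; rewrite -oppr_eq0 -bd b0 expr0n eqn0Ngt d0.
have bA0 : b%:A != 0 :> T 2 by rewrite scaler_eq0 negb_or oner_neq0 andbT.
have := level_splits T 2; rewrite poly_iter_unicriticalS.
set p := poly_iter _ 1.
have -> : p ^+ d + (c%:A)%:P - (alpha%:A)%:P = p ^+ d - (b%:A ^+ d)%:P.
  rewrite alphaA subr0 -[b%:A ^+ d](rmorphXn (in_alg (T 2))) /= bd.
  by rewrite scaleNr polyCN opprK.
move=> spl; have [|y [yd yb]] := splits_other_power d1 _ bA0 (size_poly_iter _ _ d1) spl.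
  by rewrite charT -lt0n.
pose z := p.[y] / b%:A.
have zd : z ^+ d = 1 by rewrite expr_div_n yd divff // expf_neq0.
have z1 : z != 1.
  by apply: contra_neq yb => zE; rewrite -[LHS](divfK bA0) -/z zE mul1r.
have yE : y ^+ d = z * b%:A - c%:A.
  rewrite divfK // /p poly_iter_unicriticalS hornerD horner_exp hornerX hornerC.
  by rewrite addrK.
have [t tz] := cyclotomic_inversion Kc pr_d n0 cn0 zd z1.
have yz : y ^+ d \in <<1; z>>%VS.
  have alg_z (a : K) : a%:A \in <<1; z>>%VS by rewrite memvZ // mem1v.
  by rewrite yE rpredB // rpredM // memv_adjoin.
have yty := abelian_kummer (@charT 2) (@abT 2) pr_d zd z1 tz yz.
have cTn0 : orb d (c%:A : T 2) n = 0 by rewrite orb_alg cn0 scale0r.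
have cT0 : c%:A != 0 :> T 2 by rewrite scaler_eq0 negb_or oner_neq0 andbT.
apply: (kummer_not_power (@charT 2) pr_d d2 n1 cTn0 cT0 zd z1
  (adjoin_denominator Kc yty)).
rewrite exprMn -rmorphXn /= yE rmorphB rmorphM /= tz !gal_alg orb_alg -/b.
by [].
Qed.

End ArborealGroups.

Section QuadraticArborealGroups.
Variables (K : fieldExtType rat) (n : nat) (c alpha : K).
Variable T : preimage_tower (unicritical 2 c) alpha.
Hypothesis Kc : <<1; c>>%VS = {:K}%VS.
Hypotheses (n2 : (2 < n)%N) (cn0 : orb 2 c n = 0) (c0 : c != 0).
Hypothesis abT : forall m (g h : gal_of {:T m}), (g * h = h * g)%g.

Let n0 : (0 < n)%N := ltnW (ltnW n2).
Let charK := @field_char0 K.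
Let charT m := ext_char0 (T m).
Let den := number_field_denominator Kc.

(** The target is [alpha] itself, at level [n], where the orbit is back at 0. *)
Lemma quadratic_simple_nonabelian (Q : K -> Prop) : simple_at 2 Q alpha -> False.
Proof.
move=> Qalpha; have pr2 : prime 2 by [].
have [x] := abelian_quadratic_squares (@charT n) (@abT n) (ltnW n2) (level_splits T n).
have [no1 no2] := simple_at_not_square charK pr2 n0 cn0 c0 den x Qalpha.
rewrite cn0 !sub0r => -[] //.
exact: (simple_at_not_power charK pr2 n0 cn0 Qalpha).
Qed.

(** The target is the preimage [- b] of 0, which is not in the critical
    orbit, at level [n.-1]. *)
Lemma quadratic_zero_nonabelian : c != -1 -> alpha = 0 -> False.
Proof.
move=> cN1 alpha0.
have alphaA (L : fieldExtType K) : alpha%:A = 0 :> L by rewrite alpha0 scale0r.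
pose b := orb 2 c n.-1.
have b2 : b ^+ 2 = - c by apply/eqP; rewrite -addr_eq0 -orbS prednK // cn0.
have n1 : (1 < n.-1)%N by rewrite -ltnS prednK.
have := level_splits T n; rewrite -[X in poly_iter _ X](prednK n0).
rewrite poly_iter_unicriticalS alphaA subr0.
set p := poly_iter _ _.
have -> : p ^+ 2 + (c%:A)%:P = (p - (b%:A)%:P) * (p - ((- b)%:A)%:P).
  have -> : c%:A = - (b%:A ^+ 2) :> T n.
    by rewrite -[_ ^+ 2](rmorphXn (in_alg (T n))) /= b2 scaleNr opprK.
  by rewrite scaleNr !polyCN polyC_exp; ring.
move=> spl; have {}spl := splits_dvd spl (dvdp_mull _ (dvdpp _)).
have [x] := abelian_quadratic_squares (@charT n) (@abT n) n1 spl.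
have [h1 h2 h3] := quadratic_not_square charK n0 cn0 c0 cN1 (ltnW n2) (den x).
have -> : orb 2 c n.-1 - - b = 2%:R * b by rewrite -/b; ring.
by case.
Qed.
End QuadraticArborealGroups.

Unset Implicit Arguments.

Theorem corollary1p9 (R : realType) (d n : nat) (c0 : R[i]) (G : {poly int})
    (K : fieldExtType rat) (iota : {rmorphism K -> R[i]}) (c alpha : K)
    (T : preimage_tower (unicritical d c) alpha) :
  prime d -> (0 < n)%N ->
  is_gleason_poly d n G -> root (map_poly intr G) c0 ->
  (* via iota, K is the subfield Q(c0) of the complex numbers *)
  iota c = c0 -> <<1; c>>%VS = {:K}%VS ->
  [\/ [/\ d = 2%N, (3 <= n)%N &
        exists P : prime_idealr (ring_of_integers K),
          d%:R \in P /\ padic_val P alpha 1],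
      [/\ d = 2%N, alpha = 0 & (3 <= n)%N],
      (2 < d)%N /\
        exists P : prime_idealr (ring_of_integers K),
          d%:R \in P /\ padic_val P alpha 1
    | [/\ (2 < d)%N, alpha = 0 & (2 <= n)%N]] ->
  ~ (forall s t : arboreal_gal T, (s * t = t * s)%g).
Proof.
move=> pr_d n0 defG Gc0 c0E Kc cases /arboreal_abelian abT.
have Gc : (map_poly intr G).[c] = 0.
  apply/rootP; rewrite -(fmorph_root iota) c0E -map_poly_comp.
  by rewrite (eq_map_poly (g := intr)) // => z /=; rewrite rmorph_int.
have cn0 : orb d c n = 0 by apply: (gleason_root_periodic pr_d n0 defG Gc).
have c_neq0 := gleason_root_neq0 pr_d n0 defG Gc.
have c_neqN1 := gleason_root_neqN1 n0 defG Gc.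
case: cases => [[d2 n2 [P [Pd Palpha]]] | [d2 alpha0 n2]
    | [d2 [P [Pd Palpha]]] | [d2 alpha0 n1]].
- have [Q Qalpha] := exists_simple_at Kc pr_d n0 cn0 Pd Palpha.
  have {c_neq0}c_neq0 := c_neq0 (ltnW n2).
  by subst d; apply: (quadratic_simple_nonabelian Kc n2 cn0 c_neq0 abT Qalpha).
- have {c_neq0}c_neq0 := c_neq0 (ltnW n2).
  have {c_neqN1}c_neqN1 := c_neqN1 d2 n2.
  by subst d; apply: (quadratic_zero_nonabelian Kc n2 cn0 c_neq0 abT c_neqN1).
- have [Q Qalpha] := exists_simple_at Kc pr_d n0 cn0 Pd Palpha.
  exact: (odd_simple_nonabelian Kc pr_d n0 cn0 abT d2 Qalpha).
- exact: (odd_zero_nonabelian Kc pr_d n0 cn0 abT d2 n1 (c_neq0 n1)).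
Qed.
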